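(* Let $(A_0,A_1)$ be a Banach couple, $0<q\le 1$, and let $b\in SV(0,\infty)$ be such that $\|t^{-1/q}b(t)\|_{q,(0,1)}<\infty$ and $\|t^{-1/q}b(t)\|_{q,(1,\infty)}=\infty$. Then, with equivalence of quasi-norms, $$(A_0,A_1)^{K}_{1,q,b}=(A_0^{\sim},A_1^{\sim})^{J}_{1,q,B},$$ where $B(t)=\Big(\int_0^t b(s)^q\,\frac{ds}{s}\Big)^{1/q}=\|s^{-1/q}b(s)\|_{q,(0,t)}$, $t>0$, belongs to the class $SV(0,\infty)$ of slowly varying functions.
   Context: A Banach couple $(A_0,A_1)$ is a compatible couple of Banach spaces (both continuously embedded in a common Hausdorff topological vector space) with $A_0\cap A_1\neq\{0\}$. $SV(0,\infty)$: a positive Lebesgue measurable function $b$ on $(0,\infty)$ ($0\not\equiv b\not\equiv\infty$) is slowly varying if for each $\varepsilon>0$ the function $t\mapsto t^{\varepsilon}b(t)$ is equivalent to an increasing function and $t\mapsto t^{-\varepsilon}b(t)$ is equivalent to a decreasing function (equivalent: each is bounded by a positive constant times the other). $\|\cdot\|_{q,(c,d)}$ is the $L_q$ (quasi-)norm on $(c,d)$ with respect to Lebesgue measure, so $\|t^{-1/q}b(t)\|_{q,(c,d)}=\big(\int_c^d b(t)^q\,\frac{dt}{t}\big)^{1/q}$. $K$-space: $K(t,f)=K(t,f;A_0,A_1)=\inf\{\|f_0\|_{A_0}+t\|f_1\|_{A_1}: f=f_0+f_1,\ f_i\in A_i\}$, and $(A_0,A_1)^K_{1,q,b}$ consists of all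 $f\in A_0+A_1$ with $\|f\|^K_{1,q,b}=\|t^{-1-\frac1q}b(t)K(t,f)\|_{q,(0,\infty)}<\infty$. $J$-space: $J(t,f;A_0,A_1)=\max\{\|f\|_{A_0},t\|f\|_{A_1}\}$ for $f\in A_0\cap A_1$. For a parameter $B$, $(A_0,A_1)^J_{1,q,B}$ consists of all $f\in A_0+A_1$ having a representation $f=\sum_{k\in\mathbb Z}u_k$ (convergence in $A_0+A_1$), $u_k\in A_0\cap A_1$, with $\big(\sum_{k\in\mathbb Z}(2^{-k}B(2^k)J(2^k,u_k))^q\big)^{1/q}<\infty$; its quasi-norm is the infimum of these quantities over all such representations. Gagliardo completion: $A_k^{\sim}$ ($k=0,1$) is the set of all $a\in A_0+A_1$ that are limits in $A_0+A_1$ of some sequence bounded in $A_k$, with norm $\|a\|_{A_k^{\sim}}=\inf\{\sup_n\|a_n\|_{A_k}: \|a_n-a\|_{A_0+A_1}\to0\}$. *)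

(* Defs.v *)
From mathcomp Require Export all_boot all_order all_algebra.
From mathcomp Require Export all_classical all_reals all_analysis.
From mathcomp Require Export measurable_realfun.
Export Order.TTheory GRing.Theory Num.Theory.
Export numFieldNormedType.Exports.

Set Implicit Arguments.
Unset Strict Implicit.
Unset Printing Implicit Defensive.

Global Open Scope classical_set_scope.
Global Open Scope ring_scope.
Global Open Scope ereal_scope.

(* The line with the sigma-algebra of Lebesgue measurable sets, as opposed to
   the Borel sets, which are the default measurable sets on a realType. *)
Definition lebesgueR (R : realType) : measurableType _ :=
  caratheodory_type ((@wlength R idfun)^*)%mu.

(* The L_q (quasi-)norm on the set D. *)
Definition Lq_norm (R : realType) (q : R) (D : set R) (f : R -> \bar R) : \bar R :=
  Lnorm (@completed_lebesgue_measure R) q%:E ((f \_ D) : lebesgueR R -> \bar R).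

Section SlowlyVarying.
Context {R : realType}.
Implicit Types f g b : R -> \bar R.

(* Only the values on (0, +oo) matter in this section. *)

Definition equivalent_pos f g : Prop :=
  exists2 C : R, (0 < C)%R &
    forall t, (0 < t)%R -> f t <= C%:E * g t /\ g t <= C%:E * f t.

Definition increasing_pos f : Prop :=
  forall s t, (0 < s)%R -> (s <= t)%R -> f s <= f t.

Definition decreasing_pos f : Prop :=
  forall s t, (0 < s)%R -> (s <= t)%R -> f t <= f s.

(* b may a priori take the value +oo, but not identically. *)
Definition slowly_varying b : Prop :=
  [/\ forall t, (0 < t)%R -> 0 < b t,
      measurable_fun (`]0%R, +oo[ : set (lebesgueR R))
        (b : lebesgueR R -> \bar R),
      exists2 t, (0 < t)%R & b t < +oo,
      forall eps : R, (0 < eps)%R -> exists2 g, increasing_pos g &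
        equivalent_pos (fun t => (t `^ eps)%:E * b t) g
    & forall eps : R, (0 < eps)%R -> exists2 g, decreasing_pos g &
        equivalent_pos (fun t => (t `^ (- eps))%:E * b t) g].

End SlowlyVarying.

(* A normed space A contained in V is represented by its extended norm
   N : V -> \bar R, the value +oo meaning "not in A"; a couple is a pair of
   such functions N0, N1. *)
Section Interpolation.
Context {R : realType} {V : lmodType R}.
Implicit Types (N : V -> \bar R) (f : V) (t q : R).

Definition carrier N : set V := [set f | N f < +oo].

Definition sum_space N0 N1 : set V :=
  [set f0 + f1 | f0 in carrier N0 & f1 in carrier N1]%R.

Definition K_functional N0 N1 t f : \bar R :=
  ereal_inf [set N0 p.1 + t%:E * N1 p.2 | p in [set p : V * V | f = (p.1 + p.2)%R]].

Definition J_functional N0 N1 t f : \bar R := maxe (N0 f) (t%:E * N1 f).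

Definition sum_norm N0 N1 : V -> \bar R := K_functional N0 N1 1.

Definition K_norm N0 N1 q (b : R -> \bar R) f : \bar R :=
  Lq_norm q `]0%R, +oo[
    (fun t => (t `^ (- 1 - q^-1))%:E * b t * K_functional N0 N1 t f).

Definition K_space N0 N1 q b : set V :=
  [set f | sum_space N0 N1 f /\ K_norm N0 N1 q b f < +oo].

(* f = \sum_(k in Z) u k with convergence in the norm of the sum space, the two
   ends of the range of summation tending independently to infinity
   (Negz i = - (i + 1)). *)
Definition J_representation N0 N1 f : set (int -> V) :=
  [set u | (forall k, carrier N0 (u k) /\ carrier N1 (u k)) /\
    (fun p : nat * nat => sum_norm N0 N1
        (\sum_(i < p.1) u (Negz i) + \sum_(i < p.2) u (Posz i) - f)%R)
      @ filter_prod \oo \oo --> 0].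

Definition J_quantity N0 N1 q (B : R -> \bar R) (u : int -> V) : \bar R :=
  (\esum_(k in [set: int])
     (((2 ^ (- k))%R%:E * B (2 ^ k)%R * J_functional N0 N1 (2 ^ k)%R (u k)) `^ q))
  `^ q^-1.

Definition J_space N0 N1 q B : set V :=
  [set f | sum_space N0 N1 f /\
    exists2 u, J_representation N0 N1 f u & J_quantity N0 N1 q B u < +oo].

Definition J_norm N0 N1 q B f : \bar R :=
  ereal_inf [set J_quantity N0 N1 q B u | u in J_representation N0 N1 f].

(* Extended norm of the Gagliardo completion, with respect to the couple
   (N0, N1), of the space of extended norm N (N being N0 or N1). *)
Definition gagliardo N0 N1 N f : \bar R :=
  ereal_inf [set ereal_sup (range (fun n => N (u n))) |
    u in [set u : nat -> V | sum_norm N0 N1 (u n - f)%R @[n --> \oo] --> 0]].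

Definition equivalent_norms (X : set V) N N' : Prop :=
  exists2 C : R, (0 < C)%R &
    forall f, X f -> N f <= C%:E * N' f /\ N' f <= C%:E * N f.

End Interpolation.

Record banach_couple (R : realType) := BanachCouple {
  ambient : topologicalLmodType R;
  space0 : completeNormedModType R;
  space1 : completeNormedModType R;
  emb0 : {linear space0 -> ambient};
  emb1 : {linear space1 -> ambient};
  ambient_hausdorff : hausdorff_space ambient;
  emb0_inj : injective emb0;
  emb1_inj : injective emb1;
  emb0_continuous : continuous emb0;
  emb1_continuous : continuous emb1;
  couple_nontrivial : range emb0 `&` range emb1 != [set 0%R] }.

(* The infimum is over at most one point, and +oo outside the range of i. *)
Definition emb_norm (R : realType) (A : normedModType R) (V : Type) (i : A -> V)
    (f : V) : \bar R :=
  ereal_inf [set `|a|%R%:E | a in i @^-1` [set f]].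

Definition norm0 (R : realType) (A : banach_couple R) : ambient A -> \bar R :=
  emb_norm (@emb0 R A).

Definition norm1 (R : realType) (A : banach_couple R) : ambient A -> \bar R :=
  emb_norm (@emb1 R A).

Arguments norm0 {R} A.
Arguments norm1 {R} A.

Definition gagliardo0 (R : realType) (A : banach_couple R) :
    ambient A -> \bar R :=
  gagliardo (norm0 A) (norm1 A) (norm0 A).

Definition gagliardo1 (R : realType) (A : banach_couple R) :
    ambient A -> \bar R :=
  gagliardo (norm0 A) (norm1 A) (norm1 A).

Arguments gagliardo0 {R} A.
Arguments gagliardo1 {R} A.

(* Main.v *)
Require Import Defs.
From mathcomp Require Import ring lra zify.

Set Implicit Arguments.
Unset Strict Implicit.
Unset Printing Implicit Defensive.

(** Put v = b^q, so that W(t) = B(t)^q is the integral of v(s) ds/s over (0, t),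
    and K(t) = K(t, f).

    Slow variation gives v <= C W, hence the integral over (0, oo) of
    t^(-q) min(1, t/s)^q v(t) dt/t is at most C s^(-q) W(s). If f is the sum of
    the u_k, then K(t)^q <= \sum_k (min(1, t/2^k) J(2^k, u_k))^q because q <= 1,
    and integrating term by term bounds the K-norm by the J-norm.

    Conversely, let phi(k) = K(2^k)/2^k, which decreases to 0 and at most halves
    at each step; let lam(k) be the integer with 2^lam(k) <= phi(k) < 2^(lam(k)+1).
    For each level l, choose a nearly optimal decomposition f = y_l + (f - y_l) at
    some 2^m with lam(m) = l, and y_l = 0 if there is no such m; if moreover some
    lower level is attained, then phi < 2^l and f itself lies in the Gagliardo
    completion of A_1, with norm at most 2^(l+1). The differences
    u_k = y_(lam(k+1)+1) - y_(lam(k)+1) vanish unless the level drops at k, and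
    then J(2^k, u_k) <= 12 K(2^k). The values phi(k)^q at the drops are
    dominated by the telescoping differences of 2^(q lam(k)), so their sum over
    2^k > t is at most C (K(t)/t)^q; integrating this against v(t) dt/t gives
    \sum_k (2^(-k) B(2^k) J(2^k, u_k))^q <= C ||f||^q. *)

(** * Integration on the completed Lebesgue line *)

Section Integration.
Context {R : realType}.
Local Notation mu := (@completed_lebesgue_measure R).
Local Notation leb := (@lebesgue_measure R).

(** Any nonnegative simple function below f is below g, so the suprema defining the two integrals
    compare directly. This lets integrands containing the K-functional be estimated without
    establishing their measurability. *)
Lemma ge0_le_integral_nomeas d (T : measurableType d)
    (m : {measure set T -> \bar R}) (D : set T) (f g : T -> \bar R) :
  (forall x, D x -> 0 <= f x) -> (forall x, D x -> f x <= g x) ->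
  \int[m]_(x in D) f x <= \int[m]_(x in D) g x.
Proof.
move=> f0 fg; rewrite integral_mkcond [leRHS]integral_mkcond.
have f0' x : 0 <= (f \_ D) x by exact: erestrict_ge0.
have fg' x : (f \_ D) x <= (g \_ D) x by exact: lee_restrict.
rewrite !ge0_integralTE//; last by move=> x; apply: le_trans (fg' x).
apply: le_ereal_sup => _ [h hf <-]; exists h => // x.
exact: le_trans (hf x) (fg' x).
Qed.

Lemma ge0_le_integral_subset d (T : measurableType d)
    (m : {measure set T -> \bar R}) (D E : set T) (f g : T -> \bar R) :
  D `<=` E -> (forall x, D x -> 0 <= f x) -> (forall x, E x -> 0 <= g x) ->
  (forall x, D x -> f x <= g x) ->
  \int[m]_(x in D) f x <= \int[m]_(x in E) g x.
Proof.
move=> DE f0 g0 fg; rewrite integral_mkcond [leRHS]integral_mkcond.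
apply: ge0_le_integral_nomeas => x _; first exact: erestrict_ge0.
rewrite !patchE; case: ifPn => xD.
  by rewrite ifT; [apply: fg; exact: set_mem|apply/mem_set/DE; exact: set_mem].
by case: ifPn => // xE; apply: g0; exact: set_mem.
Qed.

Lemma measurable_lebesgueR (A : set R) :
  measurable A -> measurable (A : set (lebesgueR R)).
Proof. by move=> mA; exact: sub_caratheodory. Qed.

Lemma measurable_fun_id_lebesgueR :
  measurable_fun [set: lebesgueR R] (id : lebesgueR R -> measurableTypeR R).
Proof. by move=> _ Y mY; rewrite setTI; exact: measurable_lebesgueR. Qed.

Lemma measurable_fun_lebesgueR d (T : measurableType d) (D : set R)
    (f : R -> T) : measurable D -> measurable_fun (D : set (measurableTypeR R)) f ->
  measurable_fun (D : set (lebesgueR R)) (f : lebesgueR R -> T).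
Proof.
by move=> mD mf _ Y mY; apply: measurable_lebesgueR; exact: mf.
Qed.

Lemma completed_lebesgue_measureE (A : set R) : measurable A -> mu A = leb A.
Proof. by []. Qed.

Lemma ge0_integral_image d1 d2 (T1 : measurableType d1) (T2 : measurableType d2)
    (m1 : {measure set T1 -> \bar R}) (m2 : {measure set T2 -> \bar R})
    (phi : T1 -> T2) (D : set T2) (f : T2 -> \bar R) :
  measurable_fun [set: T1] phi ->
  (forall A, measurable A -> m1 (phi @^-1` A) = m2 A) ->
  measurable D -> measurable_fun D f -> (forall x, D x -> 0 <= f x) ->
  \int[m1]_(x in phi @^-1` D) f (phi x) = \int[m2]_(x in D) f x.
Proof.
move=> mphi m12 mD mf f0.
rewrite -[LHS](@ge0_integral_pushforward _ _ T1 T2 R phi mphi m1 D f mD mf); last first.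
  by move=> y; rewrite inE; exact: f0.
by apply: (@eq_measure_integral _ _ _ D m2) => A mA _; exact: m12.
Qed.

(** Change of variables along the identity from the completed line to the Borel line. It gives
    access to the fundamental theorem of calculus for [lebesgue_measure]. *)
Lemma ge0_integral_completed (D : set R) (f : R -> \bar R) :
  measurable D -> measurable_fun (D : set (measurableTypeR R)) f ->
  (forall x, D x -> 0 <= f x) ->
  \int[mu]_(x in D) f x = \int[leb]_(x in D) f x.
Proof.
exact: (@ge0_integral_image _ _ (lebesgueR R) (measurableTypeR R) mu leb id D f
  measurable_fun_id_lebesgueR completed_lebesgue_measureE).
Qed.

End Integration.

(** * Integrals of powers over intervals *)

Section PowerIntegrals.
Context {R : realType}.
Local Notation mu := (@completed_lebesgue_measure R).
Local Notation leb := (@lebesgue_measure R).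

Lemma continuous_powR (a x : R) : (0 < x)%R -> {for x, continuous (@powR R ^~ a)}.
Proof.
move=> x0; apply: differentiable_continuous; apply/derivable1_diffP.
by apply: derivable_powR; rewrite in_itv/= x0.
Qed.

Lemma continuous_powR_div (a x : R) : (0 < x)%R ->
  {for x, continuous (fun r => r `^ a / a)%R}.
Proof. by move=> x0; apply: cvgMl; exact: continuous_powR. Qed.

Lemma is_derive_powR_div (a x : R) : (a != 0)%R -> (0 < x)%R ->
  is_derive x 1%R (fun r => r `^ a / a)%R (x `^ (a - 1))%R.
Proof.
move=> a0 x0.
have h := @is_deriveZ _ _ _ (@powR R ^~ a) a^-1%R x 1%R _ (is_derive1_powR a x0).
rewrite (_ : (fun r => _) = (a^-1 \*: (@powR R ^~ a))%R); last first.
  by apply/funext => r /=; rewrite mulrC.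
by rewrite (_ : (x `^ (a - 1))%R = (a^-1 *: (a * x `^ (a - 1)))%R)// /GRing.scale/= mulrA mulVf// mul1r.
Qed.

Lemma powR_cvgy0 (a : R) : (0 < a)%R -> (x `^ (- a))%R @[x --> +oo%R] --> 0%R.
Proof.
move=> a0; apply/cvgrPdist_le => e e0; near=> x.
(* The threshold solves x^(-a) = e. *)
have ex : (e `^ (- a^-1) <= x)%R by apply: ltW; near: x; exact: nbhs_pinfty_gt.
rewrite sub0r normrN ger0_norm ?powR_ge0// powRN invf_ple ?posrE//; last first.
  by rewrite powR_gt0// (lt_le_trans _ ex)// powR_gt0.
have -> : (e^-1 = (e `^ (- a^-1)) `^ a)%R.
  by rewrite -powRrM mulNr mulVf ?lt0r_neq0// powR_inv1// ltW.
by apply: ge0_ler_powR; rewrite ?nnegrE ?powR_ge0 ?ltW// (lt_le_trans _ ex)// powR_gt0.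
Unshelve. all: by end_near. Qed.

Lemma measurable_powR_EFin (a : R) (D : set R) : measurable D ->
  measurable_fun (D : set (measurableTypeR R)) (fun r => (r `^ a)%:E).
Proof.
move=> mD; apply/measurable_EFinP; apply: (measurable_funS measurableT) => //.
Qed.

Lemma integral_powR_itv (a s t : R) : (0 < a)%R -> (0 < s)%R -> (s <= t)%R ->
  \int[mu]_(r in `[s, t]) (r `^ (a - 1))%:E <= (t `^ a / a)%:E.
Proof.
(* The one-point interval is treated apart, since the fundamental theorem below is applied with s <
   t. The bound then comes from dropping the value of the primitive r^a / a at s. *)
move=> a0 s0; rewrite le_eqVlt => /predU1P[<-|st].
  rewrite set_itv1 ge0_integral_completed//.
  - by rewrite integral_set1 lee_fin divr_ge0 ?powR_ge0 ?ltW.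
  - exact: measurable_powR_EFin.
  - by move=> x _; rewrite lee_fin powR_ge0.
rewrite ge0_integral_completed//.
- rewrite (@continuous_FTC2 _ _ (fun r => r `^ a / a)%R) //.
  + by rewrite -EFinB lee_fin lerBlDr lerDl divr_ge0 ?powR_ge0 ?ltW.
  + apply: continuous_in_subspaceT => x; rewrite inE/= in_itv/= => /andP[sx _].
    by apply: continuous_powR; exact: lt_le_trans sx.
  + split.
    * move=> x; rewrite in_itv/= => /andP[sx _].
      have [] // := @is_derive_powR_div a x (lt0r_neq0 a0) (lt_trans s0 sx).
    * by apply: cvg_at_right_filter; exact: continuous_powR_div.
    * by apply: cvg_at_left_filter; apply: continuous_powR_div; exact: lt_trans st.
  + move=> x; rewrite in_itv/= => /andP[sx _].
    rewrite derive1E.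
    by have [_ ->] := @is_derive_powR_div a x (lt0r_neq0 a0) (lt_trans s0 sx).
- exact: measurable_powR_EFin.
- by move=> x _; rewrite lee_fin powR_ge0.
Qed.

Lemma integral_powR_itvy (a t : R) : (0 < a)%R -> (0 < t)%R ->
  \int[mu]_(r in `[t, +oo[) (r `^ (- a - 1))%:E = (t `^ (- a) / a)%:E.
Proof.
move=> a0 t0; have Na0 : (- a != 0)%R by rewrite oppr_eq0 lt0r_neq0.
rewrite ge0_integral_completed//.
- rewrite (@ge0_continuous_FTC2y _ _ (fun r => r `^ (- a) / (- a))%R _ 0%R) //.
  + by rewrite sub0e -EFinN invrN mulrN opprK.
  + by move=> x _; rewrite powR_ge0.
  + apply: continuous_in_subspaceT => x; rewrite inE/= in_itv/= andbT => sx.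
    by apply: continuous_powR; exact: lt_le_trans sx.
  + rewrite -[X in _ --> X](mul0r (- a)^-1%R)%R; apply: cvgMl; exact: powR_cvgy0.
  + move=> x tx.
    have [] // := @is_derive_powR_div (- a)%R x Na0 (lt_trans t0 tx).
  + by apply: cvg_at_right_filter; exact: continuous_powR_div.
  + move=> x; rewrite in_itv/= andbT => sx.
    rewrite derive1E.
    by have [_ ->] := @is_derive_powR_div (- a)%R x Na0 (lt_trans t0 sx).
- exact: measurable_powR_EFin.
- by move=> x _; rewrite lee_fin powR_ge0.
Qed.

End PowerIntegrals.

(** * Integrals of slowly varying weights *)

Section Weights.
Context {R : realType}.
Local Notation mu := (@completed_lebesgue_measure R).

(** Slow variation in Potter form: the auxiliary monotone functions of the definition are eliminated
    in favour of a two-sided bound on the ratio of two values. *)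
Definition sv_ratio (v : R -> R) := forall eps : R, (0 < eps)%R ->
  exists2 C : R, (0 < C)%R & forall s t : R, (0 < s)%R -> (s <= t)%R ->
    (v t <= C * (t / s) `^ eps * v s /\ v s <= C * (t / s) `^ eps * v t)%R.

Variable v : R -> R.
Hypothesis v_gt0 : forall t : R, (0 < t)%R -> (0 < v t)%R.
Hypothesis mv : measurable_fun (`]0%R, +oo[ : set (lebesgueR R)) (v : lebesgueR R -> R).
Hypothesis vratio : sv_ratio v.

(** The density of v(s) ds/s; its integral [weight] is the function W of the overview when v =
    b^q. *)
Definition dweight (r : R) : \bar R := (r^-1 * v r)%:E.
Definition weight (t : R) : \bar R := \int[mu]_(r in `]0%R, t[) dweight r.

Lemma measurable_itv_lebesgueR (i : interval R) :
  measurable ([set` i] : set (lebesgueR R)).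
Proof. by apply: measurable_lebesgueR; exact: measurable_itv. Qed.

Lemma measurable_powR_lebesgueR (a : R) (D : set R) : measurable D ->
  measurable_fun (D : set (lebesgueR R)) ((fun r : R => r `^ a)%R : lebesgueR R -> R).
Proof.
move=> mD; apply: measurable_fun_lebesgueR => //.
by apply: (measurable_funS measurableT).
Qed.

Lemma ge0_integral_itvZl (i : interval R) (f : R -> \bar R) (k : R) :
  measurable_fun ([set` i] : set (lebesgueR R)) (f : lebesgueR R -> \bar R) ->
  (forall x, x \in i -> 0 <= f x) -> (0 <= k)%R ->
  \int[mu]_(x in [set` i]) (k%:E * f x) = k%:E * \int[mu]_(x in [set` i]) f x.
Proof.
move=> mf f0 k0.
exact: (@ge0_integralZl_EFin _ (lebesgueR R) R mu _ (measurable_itv_lebesgueR i) f f0 mf k k0).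
Qed.

Lemma measurable_powR_weight (a : R) :
  measurable_fun (`]0%R, +oo[ : set (lebesgueR R))
    ((fun r => (r `^ a * v r)%:E) : lebesgueR R -> \bar R).
Proof.
apply/measurable_EFinP.
apply: (@measurable_funM _ (lebesgueR R) R _ (fun r : R => r `^ a)%R v _ mv).
apply: measurable_powR_lebesgueR; exact: measurable_itv.
Qed.

Lemma dweightE (r : R) : (0 < r)%R -> dweight r = (r `^ (- 1) * v r)%:E.
Proof. by move=> r0; rewrite /dweight powR_inv1 // ltW. Qed.

Lemma measurable_dweight :
  measurable_fun (`]0%R, +oo[ : set (lebesgueR R)) (dweight : lebesgueR R -> \bar R).
Proof.
apply: eq_measurable_fun (measurable_powR_weight (- 1)) => r.
by rewrite inE/= in_itv/= andbT => r0; rewrite dweightE.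
Qed.

Lemma dweight_ge0 (r : R) : (0 < r)%R -> 0 <= dweight r.
Proof. by move=> r0; rewrite lee_fin mulr_ge0 ?invr_ge0 ?ltW// v_gt0. Qed.

Lemma subset_itv_gt0 (i : interval R) : (forall r, r \in i -> 0 < r)%R ->
  [set` i] `<=` (`]0%R, +oo[ : set R).
Proof. by move=> h r /= /h; rewrite in_itv/= andbT. Qed.

Lemma weight_ge0 (t : R) : 0 <= weight t.
Proof.
by apply: integral_ge0 => r /=; rewrite in_itv/= => /andP[r0 _]; exact: dweight_ge0.
Qed.

Lemma ler_weight (s t : R) : (s <= t)%R -> weight s <= weight t.
Proof.
move=> st; apply: ge0_subset_integral.
- exact: measurable_itv_lebesgueR.
- exact: measurable_itv_lebesgueR.
- apply: measurable_funS measurable_dweight; first exact: measurable_itv_lebesgueR.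
  by apply: subset_itv_gt0 => r; rewrite in_itv/= => /andP[].
- by move=> r /=; rewrite in_itv/= => /andP[r0 _]; exact: dweight_ge0.
- by apply: subset_itvl; rewrite bnd_simp.
Qed.

(** On [s, t] the ratio bound gives v(r)/r <= C s^(-e) v(s) r^(e-1), and the power is integrated
    explicitly. *)
Lemma integral_dweight_itv (e : R) : (0 < e)%R ->
  exists2 C : R, (0 < C)%R & forall s t : R, (0 < s)%R -> (s <= t)%R ->
    \int[mu]_(r in `[s, t]) dweight r <= (C * (t / s) `^ e * v s)%:E.
Proof.
move=> e0; have [C C0 hC] := vratio e0.
exists (C / e)%R => [|s t s0 st]; first exact: divr_gt0.
have t0 : (0 < t)%R by exact: lt_le_trans st.
pose k := (C * s `^ (- e) * v s)%R.
have k0 : (0 <= k)%R by rewrite !mulr_ge0 ?powR_ge0 ?ltW// v_gt0.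
apply: (@le_trans _ _ (\int[mu]_(r in `[s, t]) (k%:E * (r `^ (e - 1))%:E))).
  apply: ge0_le_integral_nomeas => r /=; rewrite in_itv/= => /andP[sr rt].
    by apply: dweight_ge0; exact: lt_le_trans sr.
  have r0 : (0 < r)%R by exact: lt_le_trans sr.
  rewrite /dweight -EFinM lee_fin.
  apply: (@le_trans _ _ (r^-1 * (C * (r / s) `^ e * v s))%R).
    by apply: ler_wpM2l; [rewrite invr_ge0 ltW|have [] := hC _ _ s0 sr].
  rewrite powRM ?invr_ge0 ?(ltW r0) ?(ltW s0)// -(powR_inv1 (ltW s0)) -(powRrM s) mulN1r.
  rewrite powRD; last by rewrite (gt_eqF r0) implybT.
  by rewrite (powR_inv1 (ltW r0)) le_eqVlt /k; apply/orP; left; apply/eqP; ring.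
rewrite ge0_integral_itvZl; last exact: k0.
- apply: (@le_trans _ _ (k%:E * (t `^ e / e)%:E)).
    by rewrite lee_wpmul2l ?lee_fin//; exact: integral_powR_itv.
  rewrite -EFinM lee_fin powRM ?invr_ge0 ?(ltW t0) ?(ltW s0)// -(powR_inv1 (ltW s0)) -(powRrM s) mulN1r.
  by rewrite le_eqVlt /k; apply/orP; left; apply/eqP; ring.
- apply/measurable_EFinP; apply: measurable_powR_lebesgueR; exact: measurable_itv.
- by move=> r _; rewrite lee_fin powR_ge0.
Qed.

(** Half of the decay r^(-q) absorbs the possible growth of v, through the ratio bound with exponent
    q/2; the other half keeps the integral convergent. *)
Lemma integral_dweight_itvy (q : R) : (0 < q)%R ->
  exists2 C : R, (0 < C)%R & forall t : R, (0 < t)%R ->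
    \int[mu]_(r in `[t, +oo[) (r `^ (- q - 1) * v r)%:E <= (C * t `^ (- q) * v t)%:E.
Proof.
move=> q0; have q20 : (0 < q / 2)%R by exact: divr_gt0.
have [C C0 hC] := vratio q20.
exists (C / (q / 2))%R => [|t t0]; first exact: divr_gt0.
pose k := (C * t `^ (- (q / 2)) * v t)%R.
have k0 : (0 <= k)%R by rewrite !mulr_ge0 ?powR_ge0 ?ltW// v_gt0.
apply: (@le_trans _ _ (\int[mu]_(r in `[t, +oo[) (k%:E * (r `^ (- (q / 2) - 1))%:E))).
  apply: ge0_le_integral_nomeas => r /=; rewrite in_itv/= andbT => tr.
    by rewrite lee_fin mulr_ge0 ?powR_ge0// ltW// v_gt0// (lt_le_trans t0).
  have r0 : (0 < r)%R by exact: lt_le_trans tr.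
  rewrite -EFinM lee_fin.
  apply: (@le_trans _ _ (r `^ (- q - 1) * (C * (r / t) `^ (q / 2) * v t))%R).
    by apply: ler_wpM2l; [rewrite powR_ge0|have [] := hC _ _ t0 tr].
  rewrite powRM ?invr_ge0 ?(ltW r0) ?(ltW t0)// -(powR_inv1 (ltW t0)) -(powRrM t) mulN1r.
  have -> : (- q - 1 = (- (q / 2) - 1) + - (q / 2))%R by field.
  rewrite (@powRD _ r (- (q / 2) - 1)); last by rewrite (gt_eqF r0) implybT.
  have h : (r `^ (- (q / 2)) * r `^ (q / 2) = 1)%R.
    by rewrite -powRD ?addNr ?powRr0// (gt_eqF r0) implybT.
  rewrite le_eqVlt /k; apply/orP; left; apply/eqP.
  transitivity (C * t `^ (- (q / 2)) * v t * r `^ (- (q / 2) - 1) * (r `^ (- (q / 2)) * r `^ (q / 2)))%R; first by ring.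
  by rewrite h mulr1.
rewrite ge0_integral_itvZl; last exact: k0.
- rewrite integral_powR_itvy// -EFinM lee_fin.
  have -> : (- q = - (q / 2) + - (q / 2))%R by field.
  rewrite powRD; last by rewrite (gt_eqF t0) implybT.
  by rewrite le_eqVlt /k; apply/orP; left; apply/eqP; ring.
- apply/measurable_EFinP; apply: measurable_powR_lebesgueR; exact: measurable_itv.
- by move=> r _; rewrite lee_fin powR_ge0.
Qed.

(** On (t/2, t) the ratio bound with exponent 1 gives v(r) >= v(t) / (2C), while 1/r >= 1/t on an
    interval of length t/2. Together they yield the constant 4C. *)
Lemma le_weight : exists2 C : R, (0 < C)%R &
  forall t : R, (0 < t)%R -> (v t)%:E <= C%:E * weight t.
Proof.
have [C C0 hC] := vratio (ltr01 : 0 < 1 :> R)%R.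
exists (4 * C)%R => [|t t0]; first by rewrite mulr_gt0.
have h0 : (0 < t / 2)%R by rewrite divr_gt0.
have h1 : (t / 2 < t)%R by lra.
have C40 : (0 < 4 * C)%R by rewrite mulr_gt0.
have hm : mu (`](t / 2)%R, t[%classic : set R) = (t / 2)%:E.
  rewrite completed_lebesgue_measureE; last exact: measurable_itv.
  by rewrite lebesgue_measure_itv/= lte_fin h1 -EFinB; congr EFin; lra.
rewrite -lee_pdivrMl//.
apply: (@le_trans _ _ (\int[mu]_(r in `](t / 2)%R, t[) cst (t^-1 * ((2 * C)^-1 * v t))%:E r)).
  rewrite integral_cst; last exact: measurable_itv_lebesgueR.
  rewrite [X in _ <= _ * X]hm.
  rewrite -EFinM lee_fin le_eqVlt; apply/orP; left; apply/eqP; field.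
  by rewrite (gt_eqF C0) (gt_eqF t0).
apply: (@le_trans _ _ (\int[mu]_(r in `](t / 2)%R, t[) dweight r)).
  apply: ge0_le_integral_nomeas => r /=; rewrite in_itv/= => /andP[tr rt].
    by rewrite lee_fin !mulr_ge0 ?invr_ge0 ?mulr_ge0 ?ltW// v_gt0.
  have r0 : (0 < r)%R by exact: lt_trans tr.
  rewrite lee_fin; apply: ler_pM.
  - by rewrite invr_ge0 ltW.
  - by rewrite mulr_ge0 ?invr_ge0 ?mulr_ge0 ?ltW ?v_gt0.
  - by rewrite lef_pV2 ?posrE// ltW.
  rewrite ler_pdivrMl ?mulr_gt0//.
  apply: (@le_trans _ _ (C * (t / r) `^ 1 * v r)%R).
    by have [] := hC r t r0 (ltW rt).
  rewrite ler_pM2r ?v_gt0// mulrC ler_pM2r// powRr1; last by rewrite divr_ge0 ?ltW.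
  by rewrite ler_pdivrMr//; lra.
apply: ge0_subset_integral.
- exact: measurable_itv_lebesgueR.
- exact: measurable_itv_lebesgueR.
- apply: measurable_funS measurable_dweight; first exact: measurable_itv_lebesgueR.
  by apply: subset_itv_gt0 => r; rewrite in_itv/= => /andP[].
- by move=> r /=; rewrite in_itv/= => /andP[r0 _]; exact: dweight_ge0.
- by apply: subset_itvr; rewrite bnd_simp ltW.
Qed.

Lemma weight_gt0 (t : R) : (0 < t)%R -> 0 < weight t.
Proof.
move=> t0; have [C C0 hC] := le_weight.
have : 0 < C%:E * weight t.
  by apply: lt_le_trans (hC t t0); rewrite lte_fin v_gt0.
by rewrite pmule_rgt0 ?lte_fin.
Qed.

Lemma weight_split (s t : R) : (0 < s)%R -> (s <= t)%R ->
  weight t <= weight s + \int[mu]_(r in `[s, t]) dweight r.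
Proof.
move=> s0 st.
have mst : measurable_fun (`]0%R, t] : set (lebesgueR R)) (dweight : lebesgueR R -> \bar R).
  apply: measurable_funS measurable_dweight; first exact: measurable_itv_lebesgueR.
  by apply: subset_itv_gt0 => r; rewrite in_itv/= => /andP[].
(* The pieces form (0, t], which contains the domain (0, t) of [weight]; hence an inequality is
   proved. *)
have e : (`]0%R, s[ `|` `[s, t] = `]0%R, t] :> set R)%classic.
  by rewrite -itv_bndbnd_setU// ?bnd_simp// ltW.
rewrite -ge0_integral_setU ?e//.
- apply: ge0_subset_integral.
  + exact: measurable_itv_lebesgueR.
  + exact: measurable_itv_lebesgueR.
  + exact: mst.
  + by move=> r /=; rewrite in_itv/= => /andP[r0 _]; exact: dweight_ge0.
  + by apply: subset_itvl; rewrite bnd_simp.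
- exact: measurable_itv_lebesgueR.
- exact: measurable_itv_lebesgueR.
- by move=> r /=; rewrite in_itv/= => /andP[r0 _]; exact: dweight_ge0.
- apply/disj_setPS => r [/=]; rewrite !in_itv/= => /andP[_ rs] /andP[sr _].
  by move: rs; rewrite ltNge sr.
Qed.

Hypothesis W1 : weight 1 < +oo.

Lemma weight_lty (t : R) : weight t < +oo.
Proof.
have [t1|t1] := leP t 1%R; first by apply: le_lt_trans W1; exact: ler_weight.
have [C C0 hC] := integral_dweight_itv ltr01.
apply: le_lt_trans (weight_split ltr01 (ltW t1)) _.
by rewrite lte_add_pinfty// (le_lt_trans (hC _ _ ltr01 (ltW t1)))// ltry.
Qed.

Lemma weight_fin_num (t : R) : weight t \is a fin_num.
Proof. by rewrite ge0_fin_numE ?weight_ge0// weight_lty. Qed.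

(** W(t) exceeds W(s) by at most C (t/s)^e v(s), and v(s) <= D W(s) turns this into a multiple of
    W(s); hence the constant 1 + C D. *)
Lemma weight_ratio (e : R) : (0 < e)%R -> exists2 C : R, (0 < C)%R &
  forall s t : R, (0 < s)%R -> (s <= t)%R ->
    weight t <= (C * (t / s) `^ e)%:E * weight s.
Proof.
move=> e0; have [C C0 hC] := integral_dweight_itv e0.
have [D D0 hD] := le_weight.
exists (1 + C * D)%R => [|s t s0 st]; first by rewrite addr_gt0 ?mulr_gt0.
have ts1 : (1 <= (t / s) `^ e)%R.
  have <- : (1 `^ e = 1 :> R)%R by rewrite powR1.
  apply: ge0_ler_powR; rewrite ?nnegrE ?(ltW e0)//.
    by rewrite divr_ge0 ?(ltW s0)// (le_trans _ st)// ltW.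
  by rewrite ler_pdivlMr ?mul1r.
apply: le_trans (weight_split s0 st) _.
apply: (@le_trans _ _ (((t / s) `^ e)%:E * weight s + (C * (t / s) `^ e)%:E * (D%:E * weight s))).
  apply: leeD.
    by rewrite -[leLHS]mul1e lee_wpmul2r ?lee_fin// weight_ge0.
  apply: le_trans (hC _ _ s0 st) _.
  by rewrite EFinM lee_wpmul2l ?hD// lee_fin mulr_ge0 ?powR_ge0 ?ltW.
rewrite muleA -EFinM -ge0_muleDl ?lee_fin ?mulr_ge0 ?powR_ge0 ?(ltW C0) ?(ltW D0)//.
rewrite -EFinD lee_wpmul2r ?weight_ge0// lee_fin le_eqVlt; apply/orP; left.
by apply/eqP; ring.
Qed.

Lemma measurable_weight_min (q t : R) (E : set R) : measurable E -> E `<=` `]0%R, +oo[ ->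
  measurable_fun (E : set (lebesgueR R))
    ((fun r => (r `^ (- q - 1) * v r * (Num.min 1 (r / t)) `^ q)%:E) : lebesgueR R -> \bar R).
Proof.
move=> mE sE; apply/measurable_EFinP; apply: measurable_funM.
  apply/measurable_EFinP; apply: measurable_funS (measurable_powR_weight (- q - 1)) => //.
  exact: measurable_itv_lebesgueR.
apply: measurable_fun_lebesgueR => //.
apply: (measurable_funS measurableT) => //.
apply: (@measurableT_comp _ _ _ R R R (fun r : R => r `^ q)%R _
  (fun r : R => Num.min 1 (r / t))%R); first exact: measurable_powR.
by apply: measurable_minr => //; exact: measurable_funM.
Qed.

(** Split at t. Below t the minimum is r/t and the factors r^(-q) and r^q cancel, leaving t^(-q)
    W(t). Above t the minimum is 1, and the tail is at most C t^(-q) v(t), which [le_weight] bounds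
    through W(t). *)
Lemma integral_weight_min (q : R) : (0 < q)%R -> exists2 C : R, (0 < C)%R &
  forall t : R, (0 < t)%R ->
    \int[mu]_(r in `]0%R, +oo[)
      (r `^ (- q - 1) * v r * (Num.min 1 (r / t)) `^ q)%:E
      <= (C * t `^ (- q))%:E * weight t.
Proof.
move=> q0; have [C C0 hC] := integral_dweight_itvy q0.
have [D D0 hD] := le_weight.
exists (1 + C * D)%R => [|t t0]; first by rewrite addr_gt0 ?mulr_gt0.
have e : (`]0%R, t[ `|` `[t, +oo[ = `]0%R, +oo[ :> set R)%classic.
  by rewrite -itv_bndbnd_setU// ?bnd_simp// ltW.
have h0 (r : R) : (0 < r)%R -> 0 <= (r `^ (- q - 1) * v r * (Num.min 1 (r / t)) `^ q)%:E.
  by move=> r0; rewrite lee_fin !mulr_ge0 ?powR_ge0// ltW// v_gt0.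
rewrite -e ge0_integral_setU.
- have -> : ((1 + C * D) * t `^ (- q) = t `^ (- q) + C * D * t `^ (- q))%R by ring.
  rewrite EFinD.
  rewrite ge0_muleDl ?lee_fin ?mulr_ge0 ?powR_ge0 ?(ltW C0) ?(ltW D0)//.
  apply: leeD.
    rewrite /weight -ge0_integral_itvZl; last exact: powR_ge0.
    + apply: ge0_le_integral_nomeas => r /=; rewrite in_itv/= => /andP[r0 rt].
        exact: h0.
      rewrite dweightE// -EFinM lee_fin.
      have -> : (Num.min 1 (r / t) = r / t)%R.
        by apply/min_idPr; rewrite ler_pdivrMr// mul1r ltW.
      rewrite powRM ?invr_ge0 ?(ltW r0) ?(ltW t0)// -(powR_inv1 (ltW t0)) -powRrM mulN1r.
      rewrite (@powRD _ r (- q)); last by rewrite (gt_eqF r0) implybT.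
      have h : (r `^ (- q) * r `^ q = 1)%R.
        by rewrite -powRD ?addNr ?powRr0// (gt_eqF r0) implybT.
      rewrite le_eqVlt; apply/orP; left; apply/eqP.
      transitivity (t `^ (- q) * (r `^ (- 1) * v r) * (r `^ (- q) * r `^ q))%R; first by ring.
      by rewrite h mulr1.
    + apply: measurable_funS measurable_dweight; first exact: measurable_itv_lebesgueR.
      by apply: subset_itv_gt0 => r; rewrite in_itv/= => /andP[].
    + by move=> r /=; rewrite in_itv/= => /andP[r0 _]; exact: dweight_ge0.
  apply: (@le_trans _ _ (\int[mu]_(r in `[t, +oo[) (r `^ (- q - 1) * v r)%:E)).
    apply: ge0_le_integral_nomeas => r /=; rewrite in_itv/= andbT => tr.
      by apply: h0; exact: lt_le_trans tr.
    rewrite lee_fin ler_piMr ?mulr_ge0 ?powR_ge0//.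
      by rewrite ltW// v_gt0// (lt_le_trans t0).
    have -> : (Num.min 1 (r / t) = 1)%R.
      by apply/min_idPl; rewrite ler_pdivlMr// mul1r.
    by rewrite powR1.
  apply: le_trans (hC _ t0) _.
  have -> : (C * D * t `^ (- q) = (C * t `^ (- q)) * D)%R by ring.
  rewrite EFinM [in leRHS]EFinM -muleA lee_wpmul2l ?hD// lee_fin.
  by rewrite mulr_ge0 ?powR_ge0 ?ltW.
- exact: measurable_itv_lebesgueR.
- exact: measurable_itv_lebesgueR.
- by rewrite e; apply: measurable_weight_min => //; exact: measurable_itv.
- by rewrite e => r /=; rewrite in_itv/= andbT; exact: h0.
- apply/disj_setPS => r [/=]; rewrite !in_itv/= => /andP[_ rs] /andP[sr _].
  by move: rs; rewrite ltNge sr.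
Qed.

End Weights.

(** * From slowly varying functions to ratio bounds for their powers *)

Section SlowVariation.
Context {R : realType}.
Local Notation mu := (@completed_lebesgue_measure R).
Implicit Type b : R -> \bar R.

(** Comparing b(s) with b(t) means passing to the monotone function and back, which costs its
    equivalence constant twice. The decreasing function gives D D for one inequality, the increasing
    one C C for the other; the sum serves both. *)
Lemma slowly_varying_ratio b (e : R) : slowly_varying b -> (0 < e)%R ->
  exists2 C : R, (0 < C)%R & forall s t : R, (0 < s)%R -> (s <= t)%R ->
    b t <= (C * (t / s) `^ e)%:E * b s /\ b s <= (C * (t / s) `^ e)%:E * b t.
Proof.
move=> [b0 _ _ up down] e0.
have [g ginc [C C0 hg]] := up e e0.
have [h hdec [D D0 hh]] := down e e0.
have pow (s t : R) : (0 < s)%R -> (0 < t)%R -> ((t / s) `^ e = t `^ e * s `^ (- e))%R.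
  move=> s0 t0; rewrite powRM ?invr_ge0 ?(ltW s0) ?(ltW t0)//.
  by rewrite -(powR_inv1 (ltW s0)) -powRrM mulN1r.
have powK (s : R) : (0 < s)%R -> (s `^ (- e) * s `^ e = 1)%R.
  by move=> s0; rewrite -powRD ?addNr ?powRr0// (gt_eqF s0) implybT.
exists (C * C + D * D)%R => [|s t s0 st]; first by rewrite addr_gt0 ?mulr_gt0.
have t0 : (0 < t)%R by exact: lt_le_trans st.
have bs0 : 0 <= b s by rewrite ltW ?b0.
have bt0 : 0 <= b t by rewrite ltW ?b0.
have p0 (x a : R) : (0 <= x `^ a)%R by exact: powR_ge0.
have pe0 (x a : R) : 0 <= (x `^ a)%:E by rewrite lee_fin.
split.
- apply: (@le_trans _ _ ((D * D * (t / s) `^ e)%:E * b s)); last first.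
    rewrite lee_wpmul2r// lee_fin ler_wpM2r//.
    by rewrite lerDr mulr_ge0 ?(ltW C0).
  have h1 : (t `^ (- e))%:E * b t <= (D * D)%:E * ((s `^ (- e))%:E * b s).
    apply: le_trans (hh t t0).1 _.
    rewrite EFinM -muleA lee_wpmul2l ?lee_fin ?(ltW D0)//.
    exact: le_trans (hdec _ _ s0 st) (hh s s0).2.
  have := lee_wpmul2l (pe0 t e) h1.
  rewrite muleA -EFinM mulrC powK// mul1e => /le_trans; apply.
  by rewrite !muleA -!EFinM lee_wpmul2r// lee_fin pow// le_eqVlt; apply/orP; left; apply/eqP; ring.
- apply: (@le_trans _ _ ((C * C * (t / s) `^ e)%:E * b t)); last first.
    rewrite lee_wpmul2r// lee_fin ler_wpM2r//.
    by rewrite lerDl mulr_ge0 ?(ltW D0).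
  have h1 : (s `^ e)%:E * b s <= (C * C)%:E * ((t `^ e)%:E * b t).
    apply: le_trans (hg s s0).1 _.
    rewrite EFinM -muleA lee_wpmul2l ?lee_fin ?(ltW C0)//.
    exact: le_trans (ginc _ _ s0 st) (hg t t0).2.
  have := lee_wpmul2l (pe0 s (- e)%R) h1.
  rewrite muleA -EFinM powK// mul1e => /le_trans; apply.
  by rewrite !muleA -!EFinM lee_wpmul2r// lee_fin pow// le_eqVlt; apply/orP; left; apply/eqP; ring.
Qed.

(** Finiteness at one point spreads to every t > 0 by the ratio bound, applied on either side of
    that point. *)
Lemma slowly_varying_fin_num b (t : R) : slowly_varying b -> (0 < t)%R ->
  b t \is a fin_num.
Proof.
move=> svb t0; have [b0 _ [s s0 bs] _ _] := svb.
have [C C0 hC] := slowly_varying_ratio svb ltr01.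
rewrite ge0_fin_numE ?(ltW (b0 t t0))//.
have bsf : b s \is a fin_num by rewrite ge0_fin_numE ?(ltW (b0 s s0)).
have [st|/ltW ts] := leP s t.
- apply: le_lt_trans (hC _ _ s0 st).1 _.
  by rewrite -(fineK bsf) -EFinM ltry.
- apply: le_lt_trans (hC _ _ t0 ts).2 _.
  by rewrite -(fineK bsf) -EFinM ltry.
Qed.

(** The real-valued v = b^q; taking [fine] loses nothing on (0, oo), by [slowly_varying_fin_num]. *)
Definition sv_pow b (q : R) (t : R) : R := (fine (b t) `^ q)%R.

Lemma sv_pow_gt0 b (q t : R) : slowly_varying b -> (0 < t)%R -> (0 < sv_pow b q t)%R.
Proof.
move=> svb t0; apply: powR_gt0; apply: fine_gt0.
have [b0 _ _ _ _] := svb.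
by rewrite b0//= ltey_eq slowly_varying_fin_num.
Qed.

Lemma sv_powE b (q t : R) : slowly_varying b -> (0 < t)%R ->
  (sv_pow b q t)%:E = b t `^ q.
Proof.
by move=> svb t0; rewrite -[in RHS](fineK (slowly_varying_fin_num svb t0)) poweR_EFin.
Qed.

Lemma measurable_sv_pow b (q : R) : slowly_varying b ->
  measurable_fun (`]0%R, +oo[ : set (lebesgueR R)) (sv_pow b q : lebesgueR R -> R).
Proof.
move=> svb; have [_ mb _ _ _] := svb.
apply: (@measurableT_comp _ _ _ (lebesgueR R) R R (fun r : R => r `^ q)%R _ (fine \o b)).
  exact: measurable_powR.
apply: (@measurableT_comp _ _ _ (lebesgueR R) (\bar R) R fine _ b _ mb).
exact: fine_measurable.
Qed.

Lemma sv_ratio_sv_pow b (q : R) : (0 < q)%R -> slowly_varying b -> sv_ratio (sv_pow b q).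
Proof.
(* The exponent e/q for b becomes e after taking q-th powers. *)
move=> q0 svb e e0; have eq0 : (0 < e / q)%R by exact: divr_gt0.
have [C C0 hC] := slowly_varying_ratio svb eq0.
exists (C `^ q)%R => [|s t s0 st]; first exact: powR_gt0.
have t0 : (0 < t)%R by exact: lt_le_trans st.
have [b0 _ _ _ _] := svb.
have p0 : (0 <= C * (t / s) `^ (e / q))%R by rewrite mulr_ge0 ?powR_ge0 ?(ltW C0).
have -> : (C `^ q * (t / s) `^ e = (C * (t / s) `^ (e / q)) `^ q)%R.
  rewrite [RHS]powRM ?powR_ge0 ?(ltW C0)//; congr (_ * _)%R.
  by rewrite -powRrM; congr (_ `^ _)%R; field; rewrite gt_eqF.
have fb (r : R) : (0 < r)%R -> (0 <= fine (b r))%R.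
  by move=> r0; apply: fine_ge0; rewrite ltW// b0.
have pb (r : R) : (0 < r)%R -> (0 <= C * (t / s) `^ (e / q) * fine (b r))%R.
  by move=> r0; apply: mulr_ge0 => //; exact: fb.
rewrite /sv_pow -!powRM ?fb//; split.
- apply: ge0_ler_powR; rewrite ?nnegrE ?pb ?fb ?(ltW q0)//.
  rewrite -lee_fin EFinM !fineK ?slowly_varying_fin_num//.
  by have [] := hC _ _ s0 st.
- apply: ge0_ler_powR; rewrite ?nnegrE ?pb ?fb ?(ltW q0)//.
  rewrite -lee_fin EFinM !fineK ?slowly_varying_fin_num//.
  by have [] := hC _ _ s0 st.
Qed.

Lemma Lq_normE (q : R) (i : interval R) (f : R -> \bar R) : (q != 0)%R ->
  Lq_norm q [set` i] f = (\int[mu]_(r in [set` i]) (`|f r| `^ q)) `^ q^-1.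
Proof.
move=> q0; rewrite /Lq_norm unlock; congr (_ `^ _).
rewrite [RHS]integral_mkcond; apply: eq_integral => r _.
rewrite !patchE; case: ifPn => // _.
by rewrite abse0 poweR0r.
Qed.

Lemma Lq_norm_sv b (q : R) (i : interval R) : (0 < q)%R -> slowly_varying b ->
  (forall r, r \in i -> 0 < r)%R ->
  Lq_norm q [set` i] (fun t => (t `^ (- q^-1))%:E * b t) =
  (\int[mu]_(r in [set` i]) dweight (sv_pow b q) r) `^ q^-1.
Proof.
move=> q0 svb i0; have [b0 _ _ _ _] := svb.
rewrite Lq_normE ?gt_eqF//; congr (_ `^ _).
apply: eq_integral => r; rewrite inE => /i0 r0.
rewrite gee0_abs; last by rewrite mule_ge0 ?lee_fin ?powR_ge0// ltW// b0.
rewrite poweRM ?lee_fin ?powR_ge0 ?(ltW (b0 r r0))//.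
rewrite -(sv_powE q svb r0) poweR_EFin -EFinM /dweight -powRrM.
by rewrite mulNr mulVf ?gt_eqF// powR_inv1// ltW.
Qed.

End SlowVariation.

(** * Slow variation of W^(1/q) *)

Section WeightSlowlyVarying.
Context {R : realType}.
Variable v : R -> R.
Hypothesis v_gt0 : forall t : R, (0 < t)%R -> (0 < v t)%R.
Hypothesis mv : measurable_fun (`]0%R, +oo[ : set (lebesgueR R)) (v : lebesgueR R -> R).
Hypothesis vratio : sv_ratio v.
Hypothesis W1 : weight v 1 < +oo.

Lemma slowly_varying_weight (q : R) : (0 < q)%R ->
  slowly_varying (fun t : R => weight v t `^ q^-1).
Proof.
move=> q0; have iq0 : (0 < q^-1)%R by rewrite invr_gt0.
have W0 := weight_ge0 v_gt0.
have Wf := weight_fin_num v_gt0 mv vratio W1.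
have Winc (s t : R) : (s <= t)%R -> weight v s `^ q^-1 <= weight v t `^ q^-1.
  move=> st; apply: gt0_ler_poweR; rewrite ?in_itv/= ?W0 ?leey ?(ltW iq0)//.
  exact: ler_weight.
have Bf (t : R) : weight v t `^ q^-1 \is a fin_num by exact: fin_num_poweR.
split.
- by move=> t t0; apply: poweR_gt0; exact: (weight_gt0 v_gt0 mv vratio).
- apply: measurable_fun_lebesgueR; first exact: measurable_itv.
  rewrite (_ : (fun t => _) = EFin \o (fun t => fine (weight v t `^ q^-1))); last first.
    by apply/funext => t /=; rewrite fineK.
  apply/measurable_EFinP; apply: nondecreasing_measurable => //.
  by move=> s t st; apply: fine_le => //; exact: Winc.
- by exists 1%R => //; rewrite ltey_eq Bf.
(* W is nondecreasing, so t^e W(t)^(1/q) is itself increasing and serves as its own equivalent. *)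
- move=> e e0; exists (fun t => (t `^ e)%:E * weight v t `^ q^-1).
    move=> s t s0 st; apply: lee_pmul.
    - by rewrite lee_fin powR_ge0.
    - exact: poweR_ge0.
    - rewrite lee_fin; apply: ge0_ler_powR; rewrite ?nnegrE ?(ltW e0) ?(ltW s0)//.
      by rewrite ltW// (lt_le_trans s0).
    - exact: Winc.
  by exists 1%R => // t t0; rewrite mul1e.
- move=> e e0; have qe0 : (0 < q * e)%R by exact: mulr_gt0.
  (* The exponent q e becomes e after taking the power 1/q. *)
  have [C C0 hC] := weight_ratio v_gt0 mv vratio qe0.
  have key (s t : R) : (0 < s)%R -> (s <= t)%R ->
      (t `^ (- e))%:E * weight v t `^ q^-1 <=
      (C `^ q^-1)%:E * ((s `^ (- e))%:E * weight v s `^ q^-1).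
    move=> s0 st; have t0 : (0 < t)%R by exact: lt_le_trans st.
    have p0 : (0 <= C * (t / s) `^ (q * e))%R by rewrite mulr_ge0 ?powR_ge0 ?(ltW C0).
    apply: (@le_trans _ _ ((t `^ (- e))%:E *
        ((C * (t / s) `^ (q * e))%:E * weight v s) `^ q^-1)).
      apply: lee_wpmul2l; first by rewrite lee_fin powR_ge0.
      apply: gt0_ler_poweR; rewrite ?in_itv/= ?leey ?(ltW iq0) ?W0 ?mule_ge0 ?lee_fin//.
      exact: hC.
    rewrite poweRM ?lee_fin// poweR_EFin !muleA -!EFinM.
    apply: lee_wpmul2r; first exact: poweR_ge0.
    rewrite lee_fin powRM ?powR_ge0 ?(ltW C0)// -powRrM [(q * e)%R]mulrC mulfK ?gt_eqF//.
    rewrite powRM ?invr_ge0 ?(ltW s0) ?(ltW t0)//.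
    rewrite -(powR_inv1 (ltW s0)) -(powRrM s) mulN1r.
    have h : (t `^ (- e) * t `^ e = 1)%R.
      by rewrite -powRD ?addNr ?powRr0// (gt_eqF t0) implybT.
    rewrite le_eqVlt; apply/orP; left; apply/eqP.
    transitivity (C `^ q^-1 * s `^ (- e) * (t `^ (- e) * t `^ e))%R; first by ring.
    by rewrite h mulr1.
  pose F (s : R) := (s `^ (- e))%:E * weight v s `^ q^-1.
  (* The least decreasing majorant of F on [s, oo); by [key] it exceeds F(s) by at most the factor
     C^(1/q). *)
  exists (fun s => ereal_sup [set F t | t in [set t | (s <= t)%R]]).
    move=> s t s0 st; apply: le_ereal_sup => _ [r /= tr <-]; exists r => //.
    exact: le_trans tr.
  have D1 : (1 <= 1 + C `^ q^-1)%R by rewrite lerDl powR_ge0.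
  have F0 (s : R) : 0 <= F s by rewrite mule_ge0 ?lee_fin ?powR_ge0 ?poweR_ge0.
  exists (1 + C `^ q^-1)%R => [|t t0]; first exact: lt_le_trans D1.
  split.
    apply: (@le_trans _ _ (1%:E * ereal_sup [set F r | r in [set r | (t <= r)%R]])).
      by rewrite mul1e; apply: ereal_sup_ubound; exists t => /=.
    apply: lee_wpmul2r; last by rewrite lee_fin.
    by apply: le_ereal_sup_tmp; exists (F t) => //; exists t => /=.
  apply: ge_ereal_sup => _ [r /= tr <-].
  apply: le_trans (key _ _ t0 tr) _.
  by apply: lee_wpmul2r; [exact: F0|rewrite lee_fin lerDr].
Qed.

End WeightSlowlyVarying.

(** * Seminorms of a couple *)

Section Ereal.
Context {R : realType}.

(** The common core of the triangle inequalities for functionals defined as infima. Infinite infima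
    are separated because near-optimal elements are chosen only for finite ones. *)
Lemma le_ereal_infD (A B : set (\bar R)) (x : \bar R) :
  (forall a, A a -> 0 <= a) -> (forall b, B b -> 0 <= b) ->
  (forall a b, A a -> B b -> x <= a + b) -> x <= ereal_inf A + ereal_inf B.
Proof.
move=> A0 B0 AB.
have iA0 : 0 <= ereal_inf A by apply: le_ereal_inf_tmp => a /A0.
have iB0 : 0 <= ereal_inf B by apply: le_ereal_inf_tmp => a /B0.
have [->|Ay] := eqVneq (ereal_inf A) +oo.
  by rewrite addye ?leey// gt_eqF// (lt_le_trans _ iB0).
have [->|By] := eqVneq (ereal_inf B) +oo.
  by rewrite addey ?leey// gt_eqF// (lt_le_trans _ iA0).
have fA : ereal_inf A \is a fin_num by rewrite ge0_fin_numE// ltey.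
have fB : ereal_inf B \is a fin_num by rewrite ge0_fin_numE// ltey.
apply/lee_addgt0Pr => e e0; have e20 : (0 < e / 2)%R by exact: divr_gt0.
have [a Aa ha] := lb_ereal_inf_adherent e20 fA.
have [b Bb hb] := lb_ereal_inf_adherent e20 fB.
apply: le_trans (AB _ _ Aa Bb) _.
apply: le_trans (leeD (ltW ha) (ltW hb)) _.
by rewrite addeACA -EFinD -splitr.
Qed.

Lemma cvg0_near_le T (F : set_system T) {FF : Filter F} (f : T -> \bar R) (e : R) :
  f x @[x --> F] --> 0 -> (0 < e)%R -> \forall x \near F, f x <= e%:E.
Proof.
move=> f0 e0; have h : ereal_nbhs (0 : \bar R) (fun x => x < e%:E).
  by apply: open_ereal_lt'; rewrite lte_fin.
by apply: (@filterS _ F FF _ _ _ (f0 _ h)) => x /= /ltW.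
Qed.

Lemma ge0_cvg0 T (F : set_system T) {FF : Filter F} (f : T -> \bar R) :
  (forall x, 0 <= f x) ->
  (forall e : R, (0 < e)%R -> \forall x \near F, f x <= e%:E) ->
  f x @[x --> F] --> 0.
Proof.
move=> f0 fe; apply/fine_cvgP; split.
  apply: (@filterS _ F FF _ _ _ (fe _ ltr01)) => x fx.
  by rewrite ge0_fin_numE// (le_lt_trans fx) ?ltry.
apply/cvgrPdist_le => e e0; apply: (@filterS _ F FF _ _ _ (fe _ e0)) => x fx /=.
have fxf : f x \is a fin_num by rewrite ge0_fin_numE// (le_lt_trans fx) ?ltry.
by rewrite sub0r normrN ger0_norm ?fine_ge0// -lee_fin fineK.
Qed.

End Ereal.

(** The properties shared by the norms of the couple, the K-functional at a fixed t and the
    Gagliardo norms, so that the same lemmas apply to all of them. The value +oo marks elements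
    outside the space. *)
Definition ext_seminorm (R : realType) (V : zmodType) (N : V -> \bar R) :=
  [/\ forall x, 0 <= N x, N 0%R = 0, forall x y, N (x + y)%R <= N x + N y &
      forall x, N (- x)%R = N x].

(** * The K-functional and the Gagliardo completion of a couple *)

Section Couple.
Context {R : realType} {V : lmodType R}.
Variables N0 N1 : V -> \bar R.
Hypotheses (h0 : ext_seminorm N0) (h1 : ext_seminorm N1).
Local Notation K := (K_functional N0 N1).
Implicit Types (s t : R) (f x y : V).

Let N00 x : 0 <= N0 x. Proof. by have [] := h0. Qed.
Let N10 x : 0 <= N1 x. Proof. by have [] := h1. Qed.

Lemma K_functional_le t x y : K t (x + y)%R <= N0 x + t%:E * N1 y.
Proof. by apply: ereal_inf_lbound; exists (x, y). Qed.

Lemma K_functional_le0 t x : K t x <= N0 x.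
Proof.
rewrite -{1}[x]addr0; apply: le_trans (K_functional_le _ _ _) _.
by have [_ -> _ _] := h1; rewrite mule0 adde0.
Qed.

Lemma K_functional_le1 t x : K t x <= t%:E * N1 x.
Proof.
rewrite -{1}[x]add0r; apply: le_trans (K_functional_le _ _ _) _.
by have [_ -> _ _] := h0; rewrite add0e.
Qed.

Lemma K_functional_ge0 t x : (0 <= t)%R -> 0 <= K t x.
Proof.
by move=> t0; apply: le_ereal_inf_tmp => _ [p _ <-]; rewrite adde_ge0// mule_ge0// lee_fin.
Qed.

Lemma ext_seminorm_K t : (0 <= t)%R -> ext_seminorm (K t).
Proof.
move=> t0; have [_ N0_0 N0D N0N] := h0; have [_ N1_0 N1D N1N] := h1.
have KN x : K t (- x)%R <= K t x.
  apply: le_ereal_inf_tmp => _ [[y z] /= -> <-].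
  by rewrite opprD -[N0 y]N0N -[N1 z]N1N K_functional_le.
split.
- by move=> x; exact: K_functional_ge0.
- apply/eqP; rewrite eq_le K_functional_ge0// andbT.
  by rewrite (le_trans (K_functional_le0 _ _))// N0_0.
- move=> x y; apply: le_ereal_infD.
  + by move=> _ [p _ <-]; rewrite adde_ge0// mule_ge0// lee_fin.
  + by move=> _ [p _ <-]; rewrite adde_ge0// mule_ge0// lee_fin.
  + move=> _ _ [[a b] /= -> <-] [[c d] /= -> <-].
    rewrite addrACA; apply: le_trans (K_functional_le _ _ _) _.
    rewrite [leRHS]addeACA -ge0_muleDr//.
    by apply: leeD => //; apply: lee_wpmul2l; rewrite ?lee_fin.
- by move=> x; apply/eqP; rewrite eq_le KN/= -[leLHS](_ : K t (- - x)%R = _) ?KN ?opprK.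
Qed.

(** Each decomposition satisfies N0 + t N1 <= max(1, t/s) (N0 + s N1). Both monotonicity properties,
    of K(t) and of K(t)/t, are read off from this. *)
Lemma K_functional_scale s t f : (0 < s)%R -> (0 < t)%R ->
  K t f <= (Num.max 1 (t / s))%:E * K s f.
Proof.
move=> s0 t0; have m1 : (1 <= Num.max 1 (t / s))%R by rewrite le_max lexx.
have m0 : (0 < Num.max 1 (t / s))%R by exact: lt_le_trans m1.
rewrite -lee_pdivrMl//; apply: le_ereal_inf_tmp => _ [p /= fp <-].
rewrite lee_pdivrMl// fp; apply: le_trans (K_functional_le _ _ _) _.
rewrite ge0_muleDr ?mule_ge0 ?lee_fin ?(ltW s0)//.
apply: leeD.
  by rewrite -[leLHS]mul1e lee_wpmul2r// lee_fin.
rewrite muleA -EFinM lee_wpmul2r// lee_fin -ler_pdivrMr//.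
by rewrite le_max lexx orbT.
Qed.

Lemma K_functional_nondecreasing s t f : (0 < s)%R -> (s <= t)%R -> K s f <= K t f.
Proof.
move=> s0 st; have t0 : (0 < t)%R by exact: lt_le_trans st.
apply: le_trans (K_functional_scale f t0 s0) _.
have -> : (Num.max 1 (s / t) = 1)%R by apply/max_idPl; rewrite ler_pdivrMr// mul1r.
by rewrite mul1e.
Qed.

Lemma K_functional_div_nonincreasing s t f : (0 < s)%R -> (s <= t)%R ->
  K t f <= (t / s)%:E * K s f.
Proof.
move=> s0 st; have t0 : (0 < t)%R by exact: lt_le_trans st.
apply: le_trans (K_functional_scale f s0 t0) _.
have -> // : (Num.max 1 (t / s) = t / s)%R.
by apply/max_idPr; rewrite ler_pdivlMr// mul1r.
Qed.

Lemma sum_spaceP t f : (0 < t)%R -> sum_space N0 N1 f <-> K t f < +oo.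
Proof.
move=> t0; split.
  move=> [x /= xy] [y /= yy <-]; apply: le_lt_trans (K_functional_le _ _ _) _.
  by rewrite lte_add_pinfty// lte_mul_pinfty// lee_fin ltW.
move=> Kf; have : ereal_inf [set N0 p.1 + t%:E * N1 p.2 | p in [set p : V * V | f = (p.1 + p.2)%R]] < +oo.
  exact: Kf.
move=> /ereal_inf_lt[_ [p /= fp <-] hp].
have tN : 0 <= t%:E * N1 p.2 by rewrite mule_ge0 ?lee_fin ?(ltW t0).
exists p.1; first by apply: le_lt_trans hp; rewrite leeDl.
exists p.2 => //=; have : t%:E * N1 p.2 < +oo by apply: le_lt_trans hp; rewrite leeDr.
rewrite /carrier/= !ltey; apply: contra_neq => ->.
by rewrite gt0_muley ?lte_fin.
Qed.

(** Since K is positive and finite, 2 K lies strictly above the infimum, so some decomposition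
    attains less. *)
Lemma K_functional_near_optimal t f : (0 < t)%R -> 0 < K t f -> K t f < +oo ->
  exists x : V, N0 x <= 2%:E * K t f /\ t%:E * N1 (f - x)%R <= 2%:E * K t f.
Proof.
move=> t0 K0 Ky; have Kf : K t f \is a fin_num by rewrite ge0_fin_numE// ltW.
have : K t f < 2%:E * K t f.
  by rewrite -(fineK Kf) -EFinM lte_fin ltr_pMl ?fine_gt0 ?K0// ltr1n.
move=> /ereal_inf_lt[_ [p /= fp <-] hp].
have tN : 0 <= t%:E * N1 p.2 by rewrite mule_ge0 ?lee_fin ?(ltW t0).
exists p.1; rewrite {2}fp addrAC subrr add0r; split.
  by apply: le_trans (ltW hp); rewrite leeDl.
by apply: le_trans (ltW hp); rewrite leeDr.
Qed.

Let sum_norm_ge0 x : 0 <= sum_norm N0 N1 x.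
Proof. exact: K_functional_ge0. Qed.

Lemma gagliardo_le N f : gagliardo N0 N1 N f <= N f.
Proof.
apply: ge_ereal_inf; exists (ereal_sup (range (fun _ : nat => N f))).
  exists (fun=> f) => //=.
  have [_ S0 _ _] := ext_seminorm_K (@ler01 R).
  by rewrite subrr /sum_norm S0; exact: cvg_cst.
by apply: ge_ereal_sup => _ [n _ <-].
Qed.

Lemma gagliardo_le_lim N f (u : nat -> V) (C : \bar R) :
  (forall n, N (u n) <= C) ->
  sum_norm N0 N1 (u n - f)%R @[n --> \oo] --> 0 -> gagliardo N0 N1 N f <= C.
Proof.
move=> uC uf; apply: ge_ereal_inf; exists (ereal_sup (range (fun n => N (u n)))).
  by exists u.
by apply: ge_ereal_sup => _ [n _ <-].
Qed.

Lemma ext_seminorm_gagliardo N : ext_seminorm N -> ext_seminorm (gagliardo N0 N1 N).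
Proof.
move=> [Nge0 N_0 ND NN].
have sup_ge0 (u : nat -> V) : 0 <= ereal_sup (range (fun n => N (u n))).
  by apply: le_ereal_sup_tmp; exists (N (u 0%N)) => //; exists 0%N.
have G0 f : 0 <= gagliardo N0 N1 N f.
  by apply: le_ereal_inf_tmp => _ [u _ <-].
have [_ S0 SD SN] := ext_seminorm_K (@ler01 R).
have GN f : gagliardo N0 N1 N (- f)%R <= gagliardo N0 N1 N f.
  apply: le_ereal_inf_tmp => _ [u /= uf <-].
  apply: (@gagliardo_le_lim _ _ (fun n => - u n)%R).
    by move=> n; rewrite NN; apply: ereal_sup_ubound; exists n.
  by apply: cvg_trans uf; apply: near_eq_cvg; near=> n; rewrite -opprD /sum_norm SN.
split=> //.
- apply/eqP; rewrite eq_le G0 andbT.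
  by rewrite (le_trans (gagliardo_le _ _))// N_0.
- move=> f g; apply: le_ereal_infD.
  + by move=> _ [u _ <-].
  + by move=> _ [u _ <-].
  + move=> _ _ [u /= uf <-] [w /= wg <-].
    apply: (@gagliardo_le_lim _ _ (fun n => u n + w n)%R).
      move=> n; apply: le_trans (ND _ _) _.
      by apply: leeD; apply: ereal_sup_ubound; exists n.
    apply: ge0_cvg0 => // e e0; have e20 : (0 < e / 2)%R by exact: divr_gt0.
    apply: (@filterS2 _ _ _ _ _ _ _ (cvg0_near_le uf e20) (cvg0_near_le wg e20)) => n hu hw.
    rewrite opprD addrACA; apply: le_trans (SD _ _) _.
    by rewrite [e]splitr EFinD leeD.
- by move=> x; apply/eqP; rewrite eq_le GN/= -[leLHS](_ : gagliardo N0 N1 N (- - x)%R = _) ?GN ?opprK.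
Unshelve. all: by end_near. Qed.

(** K(t, .) is subadditive and at most max(1, t) times the sum norm, so a uniform bound survives
    convergence in the sum norm. *)
Lemma K_functional_le_lim t f (u : nat -> V) (C : \bar R) : (0 < t)%R ->
  (forall n, K t (u n) <= C) ->
  sum_norm N0 N1 (u n - f)%R @[n --> \oo] --> 0 -> K t f <= C.
Proof.
move=> t0 uC uf; apply/lee_addgt0Pr => e e0.
pose m : R := Num.max 1%R (t / 1)%R.
have m0 : (0 < m)%R by rewrite lt_max ltr01.
have [_ _ KD KN] := ext_seminorm_K (ltW t0).
have [n _ /(_ n (leqnn n)) hn] := cvg0_near_le uf (divr_gt0 e0 m0).
rewrite -(subrK (u n) f); apply: le_trans (KD _ _) _.
rewrite addeC; apply: leeD => //.
rewrite -KN opprB; apply: le_trans (K_functional_scale _ ltr01 t0) _.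
by rewrite -/m muleC -lee_pdivlMr// -EFinM.
Qed.

Lemma K_functional_le_gagliardo0 t f : (0 < t)%R ->
  K t f <= gagliardo N0 N1 N0 f.
Proof.
move=> t0; apply: le_ereal_inf_tmp => _ [u /= uf <-].
apply: (K_functional_le_lim t0 _ uf) => n.
apply: le_trans (K_functional_le0 _ _) _.
by apply: ereal_sup_ubound; exists n.
Qed.

Lemma K_functional_le_gagliardo1 t f : (0 < t)%R ->
  K t f <= t%:E * gagliardo N0 N1 N1 f.
Proof.
move=> t0; rewrite -lee_pdivrMl//; apply: le_ereal_inf_tmp => _ [u /= uf <-].
rewrite lee_pdivrMl//; apply: (K_functional_le_lim t0 _ uf) => n.
apply: le_trans (K_functional_le1 _ _) _.
rewrite lee_wpmul2l ?lee_fin ?(ltW t0)//.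
by apply: ereal_sup_ubound; exists n.
Qed.

(** The nontrivial half of the fact that Gagliardo completion leaves the K-functional unchanged; the
    other half is immediate from [gagliardo_le]. *)
Lemma K_functional_le_K_gagliardo t f : (0 < t)%R ->
  K t f <= K_functional (gagliardo N0 N1 N0) (gagliardo N0 N1 N1) t f.
Proof.
move=> t0; apply: le_ereal_inf_tmp => _ [p /= -> <-].
have [_ _ KD _] := ext_seminorm_K (ltW t0).
apply: le_trans (KD _ _) _; apply: leeD.
  exact: K_functional_le_gagliardo0.
exact: K_functional_le_gagliardo1.
Qed.

End Couple.

(** * From J to K *)

Section PowerSums.
Context {R : realType}.

(** The fractions x/(x+y) and y/(x+y) lie in [0, 1], so each is at most its q-th power when q <= 1.
    Multiply by (x+y)^q and add. *)
Lemma powR_subadditive (q x y : R) : (0 < q)%R -> (q <= 1)%R -> (0 <= x)%R -> (0 <= y)%R ->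
  ((x + y) `^ q <= x `^ q + y `^ q)%R.
Proof.
move=> q0 q1 x0 y0.
have [->|xy0] := eqVneq (x + y)%R 0%R; first by rewrite powR0 ?gt_eqF// addr_ge0 ?powR_ge0.
have s0 : (0 < x + y)%R by rewrite lt0r xy0 addr_ge0.
have part (z : R) : (0 <= z)%R -> (z <= x + y)%R ->
    (z / (x + y) * (x + y) `^ q <= z `^ q)%R.
  rewrite le_eqVlt => /predU1P[<- _|z0 zs]; first by rewrite !mul0r powR_ge0.
  have {2}-> : (z = z / (x + y) * (x + y))%R by rewrite divfK.
  rewrite [leRHS]powRM ?(ltW s0) ?divr_ge0 ?(ltW z0) ?(ltW s0)//.
  apply: ler_wpM2r; first exact: powR_ge0.
  by apply: ger1_powR => //; rewrite divr_gt0//= ler_pdivrMr// mul1r.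
have -> : ((x + y) `^ q = x / (x + y) * (x + y) `^ q + y / (x + y) * (x + y) `^ q)%R.
  by rewrite -mulrDl -mulrDl divff// mul1r.
by apply: lerD; apply: part => //; rewrite ?lerDl ?lerDr.
Qed.

Lemma poweR_subadditive (q : R) (x y : \bar R) : (0 < q)%R -> (q <= 1)%R ->
  0 <= x -> 0 <= y -> (x + y) `^ q <= x `^ q + y `^ q.
Proof.
move=> q0 q1; case: x => [x| |]//; case: y => [y| |]//; rewrite ?lee_fin => x0 y0.
- exact: powR_subadditive.
- by rewrite [(+oo `^ q)%E]poweRyr ?gt_eqF// addey ?leey.
- by rewrite [(+oo `^ q)%E]poweRyr ?gt_eqF// addye ?leey// gt_eqF// (lt_le_trans _ (poweR_ge0 _ _)).
- by rewrite [(+oo `^ q)%E]poweRyr ?gt_eqF.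
Qed.

Lemma poweR_sum_le (q : R) n (a : nat -> \bar R) : (0 < q)%R -> (q <= 1)%R ->
  (forall i, 0 <= a i) -> (\sum_(i < n) a i) `^ q <= \sum_(i < n) (a i `^ q).
Proof.
move=> q0 q1 a0; elim: n => [|n ih]; first by rewrite !big_ord0 poweR0r ?gt_eqF.
rewrite !big_ord_recr/=; apply: le_trans (poweR_subadditive q0 q1 _ (a0 n)) _.
  by apply: sume_ge0.
exact: leeD.
Qed.

Lemma esum_int (a : int -> \bar R) : (forall k, 0 <= a k) ->
  \esum_(k in [set: int]) a k = \sum_(n <oo) (a (Posz n) + a (Negz n)).
Proof.
move=> a0; rewrite nneseriesD//.
rewrite !nneseries_esumT//.
rewrite (@esumID _ _ [set Posz n | n in [set: nat]])//.
congr (_ + _).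
  by rewrite setTI esum_image// => i j _ _ [].
rewrite setTI (_ : ~` _ = [set Negz n | n in [set: nat]]); last first.
  apply/seteqP; split => [[n|n] /= h|_ [n _ <-] [m _]//].
    by exfalso; apply: h; exists n.
  by exists n.
by rewrite esum_image// => i j _ _ [].
Qed.

End PowerSums.

Section JtoK.
Context {R : realType} {V : lmodType R}.
Local Notation mu := (@completed_lebesgue_measure R).
Variables N0 N1 : V -> \bar R.
Hypotheses (h0 : ext_seminorm N0) (h1 : ext_seminorm N1).
Local Notation K := (K_functional N0 N1).
Local Notation G0 := (gagliardo N0 N1 N0).
Local Notation G1 := (gagliardo N0 N1 N1).
Variable v : R -> R.
Hypothesis v_gt0 : forall t : R, (0 < t)%R -> (0 < v t)%R.
Hypothesis mv : measurable_fun (`]0%R, +oo[ : set (lebesgueR R)) (v : lebesgueR R -> R).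
Hypothesis vratio : sv_ratio v.

(** The q-th power of the K-norm when v = b^q. *)
Definition K_integral (q : R) (f : V) : \bar R :=
  \int[mu]_(r in `]0%R, +oo[) ((r `^ (- q - 1) * v r)%:E * (K r f) `^ q).

(** A summand of the q-th power of the J-quantity of the completed couple, for B = W^(1/q). *)
Definition J_term (q : R) (u : int -> V) (k : int) : \bar R :=
  ((2 ^ k) `^ (- q))%:E * weight v (2 ^ k)%R * (J_functional G0 G1 (2 ^ k)%R (u k)) `^ q.

Let exp2_gt0 (k : int) : (0 < 2 ^ k :> R)%R. Proof. exact: exprz_gt0. Qed.

Let hG0 : ext_seminorm G0. Proof. exact: ext_seminorm_gagliardo. Qed.
Let hG1 : ext_seminorm G1. Proof. exact: ext_seminorm_gagliardo. Qed.

Lemma J_functional_ge0 t x : 0 <= J_functional G0 G1 t x.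
Proof. by rewrite /J_functional le_max; have [-> _ _ _] := hG0. Qed.

(** K is computed in the original couple and J in the completed one; the bounds of K by the two
    Gagliardo norms make this possible. *)
Lemma K_functional_le_J (r t : R) (x : V) : (0 < r)%R -> (0 < t)%R ->
  K r x <= (Num.min 1 (r / t))%:E * J_functional G0 G1 t x.
Proof.
move=> r0 t0; rewrite minEle; case: ifPn => _.
  rewrite mul1e; apply: le_trans (K_functional_le_gagliardo0 h0 h1 x r0) _.
  by rewrite /J_functional le_max lexx.
apply: le_trans (K_functional_le_gagliardo1 h0 h1 x r0) _.
have -> : r%:E * G1 x = (r / t)%:E * (t%:E * G1 x).
  by rewrite muleA -EFinM divfK// gt_eqF.
apply: lee_wpmul2l; first by rewrite lee_fin divr_ge0 ?(ltW r0) ?(ltW t0).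
by rewrite /J_functional le_max lexx orbT.
Qed.

Lemma J_term_ge0 q u k : 0 <= J_term q u k.
Proof. by rewrite /J_term !mule_ge0 ?lee_fin ?powR_ge0 ?poweR_ge0 ?weight_ge0. Qed.

(** Subadditivity of K and of the q-th power bounds the partial sums, and the bound passes to the
    limit f. The family [c] is a parameter so that its terms may be written with real values of
    J. *)
Lemma K_functional_J_representation (q r : R) f u (c : int -> \bar R) : (0 < q)%R -> (q <= 1)%R ->
  (0 < r)%R -> J_representation G0 G1 f u ->
  (forall k, c k = ((Num.min 1 (r / 2 ^ k)) `^ q)%:E * (J_functional G0 G1 (2 ^ k)%R (u k)) `^ q) ->
  (K r f) `^ q <= \sum_(n <oo) (c (Posz n) + c (Negz n)).
Proof.
move=> q0 q1 r0 uf cE; have [_ urep] := uf.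
have c0 k : 0 <= c k by rewrite cE mule_ge0 ?lee_fin ?powR_ge0 ?poweR_ge0.
set M := \sum_(n <oo) _.
have M0 : 0 <= M by apply: nneseries_ge0 => n _; rewrite adde_ge0.
have [_ K0 KD KN] := ext_seminorm_K h0 h1 (ltW r0).
have Kge0 x : 0 <= K r x by apply: K_functional_ge0 => //; exact: ltW.
have Ksum n (w : nat -> V) : K r (\sum_(i < n) w i)%R <= \sum_(i < n) K r (w i).
  elim: n => [|n ih]; first by rewrite !big_ord0 K0.
  by rewrite !big_ord_recr/=; apply: le_trans (KD _ _) _; exact: leeD.
have Kc k : K r (u k) `^ q <= c k.
  have m0 : (0 <= Num.min 1 (r / 2 ^ k))%R.
    by rewrite le_min ler01/= divr_ge0 ?(ltW r0) ?(ltW (exp2_gt0 k)).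
  rewrite cE -poweR_EFin -poweRM ?lee_fin ?J_functional_ge0//.
  apply: gt0_ler_poweR; rewrite ?in_itv/= ?leey ?Kge0 ?(ltW q0)//.
    by rewrite mule_ge0 ?lee_fin ?J_functional_ge0.
  exact: K_functional_le_J.
(* Symmetric partial sums give one sequence converging to f, extracted from the double limit along
   its diagonal. *)
pose S n : V := (\sum_(i < n) u (Negz i) + \sum_(i < n) u (Posz i))%R.
have KS n : K r (S n) <= M `^ q^-1.
  have : K r (S n) `^ q <= M.
    apply: (@le_trans _ _ (\sum_(i < n) (c (Posz i) + c (Negz i)))); last first.
      by rewrite -(big_mkord xpredT (fun i => c (Posz i) + c (Negz i))); apply: nneseries_lim_ge => i _; rewrite adde_ge0.
    rewrite big_split/= addeC.
    have hp (w : nat -> V) (d : nat -> \bar R) : (forall i, K r (w i) `^ q <= d i) ->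
        K r (\sum_(i < n) w i)%R `^ q <= \sum_(i < n) d i.
      move=> wd; apply: (@le_trans _ _ ((\sum_(i < n) K r (w i)) `^ q)).
        apply: gt0_ler_poweR; rewrite ?in_itv/= ?leey ?Kge0 ?(ltW q0)//.
          by rewrite sume_ge0.
        exact: Ksum.
      apply: (@le_trans _ _ (\sum_(i < n) K r (w i) `^ q)).
        by apply: (@poweR_sum_le _ q n (fun i => K r (w i))) => // i.
      by apply: lee_sum.
    apply: (@le_trans _ _ ((K r (\sum_(i < n) u (Negz i))%R + K r (\sum_(i < n) u (Posz i))%R) `^ q)).
      by apply: gt0_ler_poweR; rewrite ?in_itv/= ?leey ?Kge0 ?adde_ge0 ?(ltW q0)//; exact: KD.
    apply: le_trans (poweR_subadditive q0 q1 _ _) _ => //.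
    by apply: leeD; [exact: (hp (fun i => u (Negz i)) (fun i => c (Negz i)))|exact: (hp (fun i => u (Posz i)) (fun i => c (Posz i)))].
  move=> KM; have -> : K r (S n) = (K r (S n) `^ q) `^ q^-1.
    by rewrite -poweRrM mulfV ?gt_eqF// poweRe1.
  by apply: gt0_ler_poweR; rewrite ?in_itv/= ?leey ?poweR_ge0 ?M0 ?invr_ge0 ?(ltW q0).
have -> : M = (M `^ q^-1) `^ q by rewrite -poweRrM mulVf ?gt_eqF// poweRe1.
apply: gt0_ler_poweR; rewrite ?in_itv/= ?leey ?poweR_ge0 ?Kge0 ?(ltW q0)//.
apply: (K_functional_le_lim h0 h1 r0 KS).
apply: ge0_cvg0 => [n|e e0]; first exact: K_functional_ge0.
have := cvg0_near_le urep e0; case=> -[A B] /= [[a _ ha] [b _ hb]] hAB.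
exists (maxn a b) => // n /= hn.
(* The representation converges in the completed couple; this moves the convergence to the original
   sum norm. *)
apply: le_trans (K_functional_le_K_gagliardo h0 h1 _ ltr01) _.
apply: (hAB (n, n)); split => /=.
  by apply: ha => /=; apply: leq_trans hn; exact: leq_maxl.
by apply: hb => /=; apply: leq_trans hn; exact: leq_maxr.
Qed.

Lemma K_integral_le_J (q : R) : (0 < q)%R -> (q <= 1)%R ->
  exists2 C : R, (0 < C)%R & forall f u, J_representation G0 G1 f u ->
    K_integral q f <= C%:E * \esum_(k in [set: int]) J_term q u k.
Proof.
move=> q0 q1; have [C C0 hC] := integral_weight_min v_gt0 mv vratio q0.
exists C => // f u uf.
have [ucar _] := uf.
pose j k : R := fine (J_functional G0 G1 (2 ^ k)%R (u k)).
have jE k : J_functional G0 G1 (2 ^ k)%R (u k) = (j k)%:E.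
  rewrite /j fineK// ge0_fin_numE ?J_functional_ge0//.
  have [u0 u1] := ucar k; rewrite /J_functional gt_max; apply/andP; split => //.
  by rewrite lte_mul_pinfty// lee_fin ltW.
have j0 k : (0 <= j k)%R by rewrite -lee_fin -jE J_functional_ge0.
have alg (p x y z w : R) : p%:E * (x%:E * y%:E + z%:E * w%:E) =
    y%:E * (p * x)%:E + w%:E * (p * z)%:E.
  by rewrite -!EFinM -?EFinD -?EFinM; congr EFin; ring.
pose F k r : \bar R := (j k `^ q)%:E * (r `^ (- q - 1) * v r * (Num.min 1 (r / 2 ^ k)) `^ q)%:E.
have mF k : measurable_fun (`]0%R, +oo[ : set (lebesgueR R)) (F k : lebesgueR R -> \bar R).
  apply: measurable_funeM; apply: measurable_weight_min => //; exact: measurable_itv.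
have F0 k r : (`]0%R, +oo[%classic : set R) r -> 0 <= F k r.
  rewrite /= in_itv/= andbT => r0.
  by rewrite mule_ge0 ?lee_fin ?mulr_ge0 ?powR_ge0 ?(ltW (v_gt0 r0)).
have intF k : \int[mu]_(r in `]0%R, +oo[) F k r <= C%:E * J_term q u k.
  rewrite ge0_integral_itvZl; last exact: powR_ge0.
  - rewrite /J_term jE poweR_EFin muleC [leRHS]muleA.
    apply: lee_wpmul2r; first by rewrite lee_fin powR_ge0.
    apply: le_trans (hC _ (exp2_gt0 k)) _.
    by rewrite EFinM muleA.
  - by apply: measurable_weight_min => //; exact: measurable_itv.
  - move=> r; rewrite in_itv/= andbT => r0.
    by rewrite lee_fin ?mulr_ge0 ?powR_ge0 ?(ltW (v_gt0 r0)).
(* K^q is replaced by its measurable majorant first; only then are sum and integral interchanged. *)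
apply: (@le_trans _ _ (\int[mu]_(r in `]0%R, +oo[) \sum_(n <oo) (F (Posz n) r + F (Negz n) r))).
  apply: ge0_le_integral_nomeas => r /= ri; have := ri; rewrite in_itv/= andbT => r0.
    by rewrite mule_ge0 ?poweR_ge0 ?lee_fin ?mulr_ge0 ?powR_ge0 ?(ltW (v_gt0 r0)).
  apply: (@le_trans _ _ ((r `^ (- q - 1) * v r)%:E * \sum_(n <oo)
     (((Num.min 1 (r / 2 ^ Posz n)) `^ q)%:E * (j (Posz n) `^ q)%:E +
      ((Num.min 1 (r / 2 ^ Negz n)) `^ q)%:E * (j (Negz n) `^ q)%:E))).
    apply: lee_wpmul2l; first by rewrite lee_fin ?mulr_ge0 ?powR_ge0 ?(ltW (v_gt0 r0)).
    apply: (K_functional_J_representation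
      (c := fun k => ((Num.min 1 (r / 2 ^ k)) `^ q)%:E * (j k `^ q)%:E) q0 q1 r0 uf) => k.
    by rewrite jE poweR_EFin.
  rewrite -nneseriesZl; last by move=> n _; rewrite adde_ge0 ?mule_ge0 ?lee_fin ?powR_ge0.
  rewrite le_eqVlt; apply/orP; left; apply/eqP; apply: eq_eseriesr => n _.
  exact: alg.
rewrite (@integral_nneseries _ (lebesgueR R) R mu _ (measurable_itv_lebesgueR _)
   (fun n r => F (Posz n) r + F (Negz n) r)); last 2 first.
- by move=> n; apply: emeasurable_funD; exact: mF.
- by move=> n r ri; rewrite adde_ge0 ?F0.
rewrite esum_int; last by move=> k; exact: J_term_ge0.
rewrite -nneseriesZl; last by move=> n _; rewrite adde_ge0 ?J_term_ge0.
apply: lee_nneseries => n _.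
  by move=> _; apply: integral_ge0 => r ri; rewrite adde_ge0 ?F0.
rewrite (@ge0_integralD _ (lebesgueR R) R mu _ (measurable_itv_lebesgueR _) (F (Posz n)) (F (Negz n)) (F0 _) (mF _) (F0 _) (mF _)).
by rewrite ge0_muleDr ?J_term_ge0 ?leeD ?intF.
Qed.

End JtoK.

(** * Dyadic levels *)

Section EsumInt.
Context {R : realType}.

(** Windows of consecutive integers exhaust Z, so they control the whole sum of nonnegative
    terms. *)
Lemma esum_int_le (a : int -> \bar R) (M : \bar R) : (forall k, 0 <= a k) ->
  (forall (lo : int) n, \sum_(i < n) a (lo + Posz i)%R <= M) ->
  \esum_(k in [set: int]) a k <= M.
Proof.
move=> a0 aM; rewrite esum_int//; apply: lime_le.
  by apply: is_cvg_nneseries => n _ _; rewrite adde_ge0.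
apply: nearW => n; rewrite big_mkord big_split/=.
apply: le_trans (aM (- Posz n)%R (n + n)%N).
rewrite big_split_ord/= addeC.
rewrite le_eqVlt; apply/orP; left; apply/eqP; congr (_ + _); last first.
  by apply: eq_bigr => i _; congr a; rewrite PoszD addrA addNr add0r.
(* [Negz i] is -(i + 1), so the negative half of the window [-n, n) is traversed backwards. *)
rewrite [LHS](reindex_inj rev_ord_inj); apply: eq_bigr => i _; congr a => /=.
have := ltn_ord i; lia.
Qed.

End EsumInt.

Section DyadicLevels.
Context {R : realType}.
Local Open Scope ring_scope.

Lemma dyadic_level (x : R) : 0 < x -> exists l : int, 2 ^ l <= x < 2 ^ (l + 1).
Proof.
move=> x0; have ln20 : 0 < ln (2 : R) by rewrite ln_gt0// ltr1n.
have xE : x = 2 `^ (ln x / ln 2).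
  by rewrite /powR pnatr_eq0/= divfK ?gt_eqF// lnK.
(* The level is the integer part of the base-2 logarithm of x. *)
exists (Num.floor (ln x / ln 2)); rewrite -!powR_intmul// {2 3}xE; apply/andP; split.
  by apply: ler_powR; rewrite ?ler1n// floor_le.
have /andP[_ h] := floor_itv (ln x / ln 2).
rewrite /powR pnatr_eq0/= ltr_expR ltr_pM2r//.
Qed.

Variables (phi : int -> R) (lam : int -> int).
Hypothesis phi_decr : forall k, phi (k + 1) <= phi k.
Hypothesis phi_half : forall k, phi k <= 2 * phi (k + 1).
Hypothesis lamP : forall k, 2 ^ (lam k) <= phi k < 2 ^ (lam k + 1).

(** Monotonicity of [phi] excludes a rise; [phi_half] keeps phi(k+1) at or above 2^(lam(k) - 1),
    which excludes a drop by more than one. *)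
Lemma level_step k : lam (k + 1) = lam k \/ lam (k + 1) = lam k - 1.
Proof.
have /andP[a1 a2] := lamP k; have /andP[b1 b2] := lamP (k + 1).
have h1 : lam (k + 1) < lam k + 1.
  rewrite -(@ltr_eXz2l R 2) ?ltr1n//.
  by apply: le_lt_trans a2; apply: le_trans (phi_decr k).
have h2 : lam k < lam (k + 1) + 1 + 1.
  rewrite -(@ltr_eXz2l R 2) ?ltr1n//.
  apply: le_lt_trans a1 _; apply: le_lt_trans (phi_half k) _.
  by rewrite [ltRHS]expfzDr ?pnatr_eq0// mulrC ltr_pM2r.
lia.
Qed.

Lemma level_nonincr j k : j <= k -> lam k <= lam j.
Proof.
move=> jk; have -> : k = j + Posz (absz (k - j)) by lia.
elim: (absz (k - j)) => [|n ih]; first by rewrite addr0.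
have -> : j + Posz n.+1 = j + Posz n + 1 by lia.
move: ih; have [->//|->] := level_step (j + Posz n).
by move: (lam _) (lam _) => x y; lia.
Qed.

Lemma level_lt j k : lam k < lam j -> j < k.
Proof. by move=> h; rewrite ltNge; apply/negP => /level_nonincr; rewrite leNgt h. Qed.

(** A discrete intermediate value argument: levels fall by unit steps, so they cannot go from above
    l to below l without attaining it. *)
Lemma level_unattained k l : lam k < l -> (forall m, lam m != l) ->
  forall m, lam m < l.
Proof.
move=> kl nl m; rewrite ltNge; apply/negP => lm.
have mk : m < k by apply: level_lt; exact: lt_le_trans lm.
have h n : l < lam (m + Posz n).
  elim: n => [|n ih].
    by rewrite addr0 lt_neqAle lm andbT eq_sym nl.
  have := nl (m + Posz n.+1).
  have -> : m + Posz n.+1 = m + Posz n + 1 by lia.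
  move: ih; have [->//|->] := level_step (m + Posz n).
  by move: (lam _) => x; lia.
have := h (absz (k - m)).
have -> : m + Posz (absz (k - m)) = k by lia.
by rewrite ltNge (ltW kl).
Qed.

Variable q : R.
Hypothesis q0 : 0 < q.

(** At a drop the difference equals 2^(q lam(k)) (1 - 2^(-q)), while phi(k) < 2 2^(lam(k)). *)
Lemma level_pow_drop k : lam (k + 1) = lam k - 1 ->
  (phi k) `^ q <= 2 `^ q / (1 - 2 `^ (- q)) *
    ((2 ^ lam k) `^ q - (2 ^ lam (k + 1)) `^ q).
Proof.
move=> ->; have e2 (l : int) : 0 < 2 ^ l :> R by exact: exprz_gt0.
have c1 : 2 `^ (- q) < 1 :> R.
  by rewrite powRN invf_lt1 ?powR_gt0// -[ltLHS](powRr0 2) /powR pnatr_eq0/= ltr_expR ltr_pM2r// ln_gt0// ltr1n.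
have -> : (2 ^ (lam k - 1)) `^ q = (2 ^ lam k) `^ q * 2 `^ (- q) :> R.
  have -> : 2 ^ (lam k - 1) = 2 ^ lam k * 2 `^ (- 1) :> R.
    by rewrite expfzDr ?pnatr_eq0// powR_inv1.
  by rewrite powRM ?powR_ge0 ?(ltW (e2 _))// -powRrM mulN1r.
have -> : 2 `^ q / (1 - 2 `^ (- q)) * ((2 ^ lam k) `^ q - (2 ^ lam k) `^ q * 2 `^ (- q))
    = 2 `^ q * (2 ^ lam k) `^ q :> R.
  by field; rewrite subr_eq0 gt_eqF.
have /andP[a1 a2] := lamP k.
have p0 : 0 < phi k by exact: lt_le_trans a1.
have e20 : 0 <= 2 * 2 ^ lam k :> R by rewrite mulr_ge0 ?(ltW (e2 _)).
rewrite -powRM ?(ltW (e2 _))//.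
apply: ge0_ler_powR; rewrite ?nnegrE ?(ltW p0) ?(ltW q0)//.
by rewrite ltW// mulrC; move: a2; rewrite expfzDr ?pnatr_eq0.
Qed.

Lemma level_pow_decr k : (2 ^ lam (k + 1)) `^ q <= (2 ^ lam k) `^ q :> R.
Proof.
apply: ge0_ler_powR; rewrite ?nnegrE ?exprz_ge0 ?(ltW q0)//.
by rewrite ler_eXz2l ?ltr1n//; apply: level_nonincr; lia.
Qed.

(** The indicator selects a final segment of indices, on which the sum telescopes and is at most its
    first power, hence at most phi^q at the first selected index. *)
Lemma level_pow_sum (r c : R) (lo : int) n : 0 <= c ->
  (forall k, r < 2 ^ k -> (phi k) `^ q <= c) ->
  \sum_(i < n) (((2 ^ lam (lo + Posz i)) `^ q - (2 ^ lam (lo + Posz i + 1)) `^ q) *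
     (r < 2 ^ (lo + Posz i))%R%:R) <= c.
Proof.
move=> c0 hc; have shift (m : int) i : m + Posz i.+1 = m + 1 + Posz i by lia.
elim: n lo => [|n ih] lo; first by rewrite big_ord0.
(* If the first index is not selected, its term vanishes and induction applies; otherwise every
   indicator is bounded by 1. *)
have [rlo|rlo] := ltP r (2 ^ lo); last first.
  rewrite big_ord_recl/= addr0 ltNge rlo mulr0 add0r.
  under eq_bigr do rewrite shift.
  exact: ih.
apply: (@le_trans _ _ (\sum_(i < n.+1)
    (- (2 ^ lam (lo + Posz i.+1)) `^ q - - (2 ^ lam (lo + Posz i)) `^ q))).
  apply: ler_sum => i _.
  have -> : lo + Posz i.+1 = lo + Posz i + 1 by lia.
  rewrite [leRHS]addrC opprK; apply: ler_piMr; last by rewrite lern1 leq_b1.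
  by rewrite subr_ge0 level_pow_decr.
rewrite -(big_mkord xpredT (fun i => - (2 ^ lam (lo + Posz i.+1)) `^ q - - (2 ^ lam (lo + Posz i)) `^ q)).
rewrite (@telescope_sumr _ 0%N n.+1 (fun i => - (2 ^ lam (lo + Posz i)) `^ q))// addr0 opprK.
apply: le_trans (hc _ rlo); rewrite addrC.
apply: (@le_trans _ _ ((2 ^ lam lo) `^ q)); first by rewrite gerBl powR_ge0.
have /andP[a1 _] := lamP lo.
apply: ge0_ler_powR; rewrite ?nnegrE ?exprz_ge0 ?(ltW q0)//.
by apply: le_trans a1; rewrite exprz_ge0.
Qed.

End DyadicLevels.

(** * From K to J *)

Lemma exp2_unbounded (R : realType) (x : R) : exists N : nat, (x <= 2 ^ Posz N)%R.
Proof.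
have [n xn] : exists n : nat, (x <= n%:R)%R.
  exists (Num.bound `|x|%R); apply: le_trans (ler_norm x) _; apply: ltW.
  exact: archi_boundP.
exists n; apply: le_trans xn _; rewrite -exprnP -natrX ler_nat.
by rewrite ltnW// ltn_expl.
Qed.

Lemma ler_exp2z (R : realType) (m n : int) : (m <= n)%R -> (2 ^ m <= 2 ^ n :> R)%R.
Proof. by move=> mn; rewrite ler_eXz2l// ltr1n. Qed.

(** * The profile of a fixed element and its level decomposition *)

Section Profile.
Context {R : realType} {V : lmodType R}.
Local Notation mu := (@completed_lebesgue_measure R).
Variables N0 N1 : V -> \bar R.
Hypotheses (h0 : ext_seminorm N0) (h1 : ext_seminorm N1).
Local Notation K := (K_functional N0 N1).
Variable v : R -> R.
Hypothesis v_gt0 : forall t : R, (0 < t)%R -> (0 < v t)%R.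
Hypothesis mv : measurable_fun (`]0%R, +oo[ : set (lebesgueR R)) (v : lebesgueR R -> R).
Hypothesis vratio : sv_ratio v.
Hypothesis W1 : weight v 1 < +oo.
Hypothesis Winfty : \int[mu]_(r in `]1%R, +oo[) dweight v r = +oo.
Variables (q : R) (f : V).
Hypothesis q0 : (0 < q)%R.
Hypothesis fsum : sum_space N0 N1 f.
Local Notation I := (K_integral N0 N1 v q f).
Hypothesis Ify : I < +oo.

Definition K_profile (r : R) : R := fine (K r f).

Lemma K_profileE r : (0 < r)%R -> (K_profile r)%:E = K r f.
Proof.
move=> r0; rewrite fineK// ge0_fin_numE; last exact: (K_functional_ge0 h0 h1 _ (ltW r0)).
exact: (sum_spaceP h0 h1 f r0).1.
Qed.

Lemma K_profile_ge0 r : (0 < r)%R -> (0 <= K_profile r)%R.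
Proof. by move=> r0; apply: fine_ge0; exact: (K_functional_ge0 h0 h1 _ (ltW r0)). Qed.

Lemma K_profile_nondecreasing s t : (0 < s)%R -> (s <= t)%R -> (K_profile s <= K_profile t)%R.
Proof.
move=> s0 st; have t0 : (0 < t)%R by exact: lt_le_trans st.
by rewrite -lee_fin !K_profileE//; exact: (K_functional_nondecreasing h0 h1).
Qed.

Lemma K_profile_div_nonincreasing s t : (0 < s)%R -> (s <= t)%R ->
  (K_profile t / t <= K_profile s / s)%R.
Proof.
move=> s0 st; have t0 : (0 < t)%R by exact: lt_le_trans st.
have := K_functional_div_nonincreasing h0 h1 f s0 st.
rewrite -!K_profileE// -EFinM lee_fin => h.
by rewrite ler_pdivrMr//; apply: le_trans h _; rewrite le_eqVlt; apply/orP; left; apply/eqP; ring.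
Qed.

Lemma K_profile_div_ge0 r : (0 < r)%R -> (0 <= K_profile r / r)%R.
Proof. by move=> r0; rewrite divr_ge0 ?K_profile_ge0 ?(ltW r0). Qed.

(** Distributing the power of r displays the nonincreasing quantity K(r)/r against the measure v(r)
    dr/r. *)
Lemma K_integralE : I = \int[mu]_(r in `]0%R, +oo[)
  (dweight v r * ((K_profile r / r) `^ q)%:E).
Proof.
apply: eq_integral => r; rewrite inE/= in_itv/= andbT => r0.
rewrite -K_profileE// poweR_EFin dweightE// -!EFinM; congr EFin.
rewrite powRM ?invr_ge0 ?K_profile_ge0 ?(ltW r0)//.
rewrite -(powR_inv1 (ltW r0)) -powRrM mulN1r.
rewrite powRD; last by rewrite (gt_eqF r0) implybT.
by ring.
Qed.

(** Restrict the integral to (0, s), where K(r)/r >= K(s)/s. *)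
Lemma weight_K_profile_le s : (0 < s)%R ->
  weight v s * ((K_profile s / s) `^ q)%:E <= I.
Proof.
move=> s0; rewrite K_integralE muleC /weight -ge0_integral_itvZl; last exact: powR_ge0.
- apply: ge0_le_integral_subset.
  + by apply: subset_itvl.
  + move=> r /=; rewrite in_itv/= => /andP[r0 _].
    by rewrite mule_ge0 ?lee_fin ?powR_ge0//; have := dweight_ge0 v_gt0 r0; rewrite lee_fin.
  + move=> r /=; rewrite in_itv/= => /andP[r0 _].
    by rewrite mule_ge0 ?lee_fin ?powR_ge0//; have := dweight_ge0 v_gt0 r0; rewrite lee_fin.
  + move=> r /=; rewrite in_itv/= => /andP[r0 rs].
    rewrite muleC; apply: lee_wpmul2l; first exact: dweight_ge0.
    rewrite lee_fin; apply: ge0_ler_powR; rewrite ?nnegrE ?K_profile_div_ge0 ?(ltW q0)//.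
    by apply: K_profile_div_nonincreasing => //; exact: ltW.
- apply: measurable_funS (measurable_dweight mv); first exact: measurable_itv_lebesgueR.
  by apply: subset_itv_gt0 => r; rewrite in_itv/= => /andP[].
- by move=> r; rewrite in_itv/= => /andP[r0 _]; exact: dweight_ge0.
Qed.

(** Here the divergence of the integral of v(r) dr/r over (1, oo) enters: if K(t)/t stayed above e,
    the K-integral would be infinite. It yields convergence at the upper end of the
    representation. *)
Lemma K_profile_div_small (e : R) : (0 < e)%R ->
  exists2 t : R, (0 < t)%R & (K_profile t / t < e)%R.
Proof.
move=> e0; apply: contrapT => /forall2NP h.
have he t : (0 < t)%R -> (e <= K_profile t / t)%R.
  by move=> t0; rewrite leNgt; apply/negP => ht; have [] := h t.
suff : (e `^ q)%:E * +oo <= I.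
  by rewrite gt0_muley ?lte_fin ?powR_gt0// leye_eq => /eqP Iy; have := Ify; rewrite Iy.
rewrite -Winfty -ge0_integral_itvZl; last exact: powR_ge0.
- rewrite K_integralE; apply: ge0_le_integral_subset.
  + by apply: subset_itvr; rewrite bnd_simp.
  + move=> r /=; rewrite in_itv/= andbT => r1.
    have r0 : (0 < r)%R by exact: lt_trans r1.
    by apply: mule_ge0; [rewrite lee_fin powR_ge0|exact: dweight_ge0].
  + move=> r /=; rewrite in_itv/= andbT => r0.
    by apply: mule_ge0; [exact: dweight_ge0|rewrite lee_fin powR_ge0].
  + move=> r /=; rewrite in_itv/= andbT => r1.
    have r0 : (0 < r)%R by exact: lt_trans r1.
    rewrite muleC; apply: lee_wpmul2l; first exact: dweight_ge0.
    rewrite lee_fin; apply: ge0_ler_powR; rewrite ?nnegrE ?K_profile_div_ge0 ?(ltW q0) ?(ltW e0)//.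
    exact: he.
- apply: measurable_funS (measurable_dweight mv); first exact: measurable_itv_lebesgueR.
  by apply: subset_itv_gt0 => r; rewrite in_itv/= andbT => r1; exact: lt_trans r1.
- by move=> r; rewrite in_itv/= andbT => r1; apply: dweight_ge0 => //; exact: lt_trans r1.
Qed.

(** W(s) (K(s)/s)^q is bounded by I, while [weight_ratio] with exponent q/2 keeps W(s) above a
    multiple of s^(q/2) near 0, so K(s) tends to 0 with s. It yields convergence at the lower
    end. *)
Lemma K_profile_small (e : R) : (0 < e)%R ->
  exists2 t : R, (0 < t)%R & (K_profile t <= e)%R.
Proof.
move=> e0; have q20 : (0 < q / 2)%R by rewrite divr_gt0.
have [C C0 hC] := weight_ratio v_gt0 mv vratio q20.
have Wf t := weight_fin_num v_gt0 mv vratio W1 t.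
pose w t := fine (weight v t).
have w1 : (0 < w 1)%R.
  by apply: fine_gt0; rewrite W1 andbT; exact: (weight_gt0 v_gt0 mv vratio).
have w0 t : (0 <= w t)%R by rewrite fine_ge0// weight_ge0.
have I0 : 0 <= I.
  apply: integral_ge0 => r /=; rewrite in_itv/= andbT => r0.
  by rewrite mule_ge0 ?poweR_ge0// lee_fin mulr_ge0 ?powR_ge0 ?(ltW (v_gt0 r0)).
pose J := fine I; have JE : I = J%:E by rewrite fineK// ge0_fin_numE.
have J0 : (0 <= J)%R by rewrite fine_ge0.
(* Both bounds combine into K(s)^q <= D s^(q/2) for s <= 1. *)
pose D : R := (C * J / w 1)%R.
have D0 : (0 <= D)%R by rewrite !mulr_ge0 ?invr_ge0 ?(ltW C0) ?(ltW w1).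
have key s : (0 < s)%R -> (s <= 1)%R -> (K_profile s `^ q <= D * s `^ (q / 2))%R.
  move=> s0 s1.
  have := weight_K_profile_le s0; rewrite JE -(fineK (Wf s)) -EFinM lee_fin -/(w s) => a1.
  have := hC _ _ s0 s1; rewrite -(fineK (Wf s)) -(fineK (Wf 1%R)) -EFinM lee_fin -/(w s) -/(w 1%R) => a2.
  have e1 : ((K_profile s / s) `^ q = K_profile s `^ q * s `^ (- q))%R.
    rewrite powRM ?invr_ge0 ?K_profile_ge0 ?(ltW s0)//.
    by rewrite -(powR_inv1 (ltW s0)) -powRrM mulN1r.
  have e2 : ((1 / s) `^ (q / 2) = s `^ (- (q / 2)))%R.
    by rewrite div1r -(powR_inv1 (ltW s0)) -powRrM mulN1r.
  rewrite e1 in a1; rewrite e2 in a2.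
  have p1 : (s `^ (- q) = s `^ (- (q / 2)) * s `^ (- (q / 2)))%R.
    by rewrite -powRD ?(gt_eqF s0) ?implybT//; congr powR; field.
  have p2 : (s `^ (- (q / 2)) * s `^ (q / 2) = 1)%R.
    by rewrite -powRD ?addNr ?powRr0// (gt_eqF s0) implybT.
  have p0 : (0 < s `^ (- (q / 2)))%R by exact: powR_gt0.
  set x := (s `^ (- (q / 2)))%R in a1 a2 p1 p2 p0.
  set y := (s `^ (q / 2))%R in p2 *.
  have y0 : (0 <= y)%R by exact: powR_ge0.
  have k0 : (0 <= K_profile s `^ q)%R by exact: powR_ge0.
  set k := (K_profile s `^ q)%R in a1 k0 *.
  rewrite p1 in a1.
  (* Multiplying [a2] by k x produces C times the left side of [a1]. *)
  have h : (w 1 * k * x <= C * J)%R.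
    apply: (@le_trans _ _ (C * x * w s * k * x)%R).
      by do 2 (apply: ler_wpM2r; [by rewrite ?(ltW p0)|]).
    apply: (@le_trans _ _ (C * (w s * (k * (x * x))))%R); last by rewrite ler_pM2l.
    by rewrite le_eqVlt; apply/orP; left; apply/eqP; ring.
  have -> : k = (w 1 * k * x * y / w 1)%R.
    by rewrite -[(w 1 * k * x * y)%R]mulrA p2 mulr1 mulrAC mulfV ?mul1r ?gt_eqF.
  have -> : (D * y = C * J * y / w 1)%R by rewrite /D mulrAC.
  by rewrite ler_pM2r ?invr_gt0//; apply: ler_wpM2r.
have D1 : (0 < D + 1)%R by rewrite ltr_wpDl.
(* Chosen so that s^(q/2) <= e^q / (D + 1); D itself may be 0. *)
pose s : R := Num.min 1%R ((e `^ q / (D + 1)) `^ (2 / q))%R.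
have eD : (0 < e `^ q / (D + 1))%R by rewrite divr_gt0 ?powR_gt0.
have s0 : (0 < s)%R by rewrite lt_min ltr01/= powR_gt0.
exists s => //; rewrite leNgt; apply/negP => eK.
have := key s s0; rewrite ge_min lexx => /(_ isT); apply/negP; rewrite -ltNge.
apply: (@le_lt_trans _ _ (e `^ q)%R); last first.
  by apply: gt0_ltr_powR; rewrite ?in_itv/= ?nnegrE ?(ltW e0) ?K_profile_ge0.
have : (s `^ (q / 2) <= e `^ q / (D + 1))%R.
  have -> : (e `^ q / (D + 1) = ((e `^ q / (D + 1)) `^ (2 / q)) `^ (q / 2))%R.
    rewrite -powRrM (_ : 2 / q * (q / 2) = 1)%R ?powRr1 ?(ltW eD)//.
    by field; rewrite gt_eqF.
  apply: ge0_ler_powR; rewrite ?nnegrE ?powR_ge0 ?(ltW s0) ?(ltW q20)//.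
  by rewrite ge_min lexx orbT.
rewrite ler_pdivlMr// => h; apply: le_trans h; rewrite mulrC.
by apply: ler_wpM2l; [exact: powR_ge0|rewrite lerDl].
Qed.

Local Notation G0 := (gagliardo N0 N1 N0).
Local Notation G1 := (gagliardo N0 N1 N1).
Local Notation phi := (fun k : int => (K_profile (2 ^ k) / 2 ^ k)%R).

Let exp2_gt0 (k : int) : (0 < 2 ^ k :> R)%R. Proof. exact: exprz_gt0. Qed.

Lemma dyadic_profile_decr (k : int) : (phi (k + 1)%R <= phi k)%R.
Proof.
apply: K_profile_div_nonincreasing => //.
by apply: ler_exp2z; rewrite lerDl.
Qed.

Lemma dyadic_profile_half (k : int) : (phi k <= 2 * phi (k + 1)%R)%R.
Proof.
have e2 : (2 ^ (k + 1) = 2 ^ k * 2 :> R)%R by rewrite expfzDr ?pnatr_eq0// expr1z.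
have -> : (2 * (K_profile (2 ^ (k + 1)) / 2 ^ (k + 1)) = K_profile (2 ^ (k + 1)) / 2 ^ k)%R.
  by rewrite {2}e2; field; rewrite gt_eqF.
rewrite ler_pM2r ?invr_gt0//; apply: K_profile_nondecreasing => //.
by rewrite e2 ler_pMr// ler1n.
Qed.

Hypothesis K_profile_gt0 : forall t : R, (0 < t)%R -> (0 < K_profile t)%R.
Variable lam : int -> int.
Hypothesis lamP : forall k, (2 ^ (lam k) <= phi k < 2 ^ (lam k + 1))%R.

(** The index m is existential and the element is attached to the level alone, so that consecutive
    differences vanish wherever the level stays constant. *)
Definition level_part (l : int) (x : V) : Prop :=
  (exists2 m, lam m = l & N0 x <= (2 * K_profile (2 ^ m))%:E /\
    N1 (f - x)%R <= (2 * phi m)%:E) \/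
  (x = 0%R /\ forall m, lam m != l).

Lemma near_optimal_dyadic (m : int) : exists x : V,
  N0 x <= (2 * K_profile (2 ^ m))%:E /\ N1 (f - x)%R <= (2 * phi m)%:E.
Proof.
have [x [x0 x1]] : exists x : V, N0 x <= 2%:E * K (2 ^ m)%R f /\
    (2 ^ m)%:E * N1 (f - x)%R <= 2%:E * K (2 ^ m)%R f.
  apply: (K_functional_near_optimal h0 h1) => //.
    by rewrite -K_profileE// lte_fin K_profile_gt0.
  by rewrite -K_profileE// ltry.
rewrite -K_profileE// -EFinM in x0 x1; exists x; split => //.
by rewrite mulrA mulrC EFinM lee_pdivlMl.
Qed.

Lemma exists_level_part (l : int) : exists x, level_part l x.
Proof.
have [[m ml]|nl] := pselect (exists m, lam m = l).
  by have [x hx] := near_optimal_dyadic m; exists x; left; exists m.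
exists 0%R; right; split => // m; apply/eqP => ml; apply: nl; by exists m.
Qed.

Variable y : int -> V.
Hypothesis yP : forall l, level_part l (y l).

(** A level strictly above lam(k+1) can only be attained at some m <= k, where K(2^m) <= K(2^k). *)
Lemma level_part_N0 (k l : int) : (lam (k + 1) < l)%R ->
  N0 (y l) <= (2 * K_profile (2 ^ k))%:E.
Proof.
move=> kl; have [[m ml [h _]]|[-> _]] := yP l.
  apply: le_trans h _; rewrite lee_fin ler_pM2l//.
  apply: K_profile_nondecreasing => //.
  rewrite -ml in kl.
  have := level_lt dyadic_profile_decr dyadic_profile_half lamP kl.
  by rewrite ltzD1; exact: ler_exp2z.
have [_ -> _ _] := h0.
by rewrite lee_fin mulr_ge0// ltW// K_profile_gt0.
Qed.

(** With x_n the near-optimal A_0 part of f at 2^(-n), the elements f - x_n are bounded in A_1 by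
    2c. They converge to f because x_n tends to 0 in A_0, by [K_profile_small]. *)
Lemma gagliardo1_le_level (c : R) : (forall m, (phi m <= c)%R) -> G1 f <= (2 * c)%:E.
Proof.
move=> phic; have [x hx] := choice near_optimal_dyadic.
have [_ _ _ NN0] := h0.
apply: (@gagliardo_le_lim _ _ _ _ _ _ (fun n => f - x (- Posz n))%R).
  move=> n; apply: le_trans (hx (- Posz n)%R).2 _.
  by rewrite lee_fin ler_pM2l.
apply: ge0_cvg0 => [n|e e0]; first exact: (K_functional_ge0 h0 h1).
have e20 : (0 < e / 2)%R by rewrite divr_gt0.
have [t t0 ht] := K_profile_small e20.
have [N hN] : exists N : nat, (2 ^ (- Posz N) <= t :> R)%R.
  have [N hN] := exp2_unbounded t^-1; exists N.
  by rewrite -exprnN invf_ple ?posrE ?exprn_gt0.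
exists N => // n /= Nn.
apply: (@le_trans _ _ (N0 (- x (- Posz n))%R)).
  have -> : (f - x (- Posz n) - f = - x (- Posz n))%R by rewrite addrAC subrr add0r.
  exact: K_functional_le0.
rewrite NN0; apply: le_trans (hx (- Posz n)%R).1 _.
rewrite lee_fin -ler_pdivlMl// mulrC; apply: le_trans ht.
apply: K_profile_nondecreasing => //; apply: le_trans hN.
by apply: ler_exp2z; rewrite lerN2 lez_nat.
Qed.

(** If l is attained at m, the A_1 part is at most 2 phi(m) < 2 2^(l+1). If not, then lam(k) = l - 1
    forces all levels below l, so phi < 2^l everywhere and f itself is bounded by
    [gagliardo1_le_level]. *)
Lemma level_part_G1 (k l : int) : lam k = l \/ lam k = (l - 1)%R ->
  G1 (f - y l)%R <= (4 * 2 ^ l)%:E.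
Proof.
move=> kl; have [[m ml [_ h]]|[-> nl]] := yP l.
  apply: le_trans (gagliardo_le h0 h1 _ _) _; apply: le_trans h _.
  have /andP[_ b] := lamP m.
  rewrite lee_fin; have -> : (4 * 2 ^ l = 2 * 2 ^ (lam m + 1) :> R)%R.
    by rewrite ml expfzDr ?pnatr_eq0// expr1z; ring.
  by rewrite ler_pM2l// ltW.
rewrite subr0; have [kl1|kl1] := kl; first by have := nl k; rewrite kl1 eqxx.
apply: (@le_trans _ _ (2 * 2 ^ l)%:E); last first.
  by rewrite lee_fin ler_pM2r// ler_nat.
apply: gagliardo1_le_level => m; have /andP[_ b] := lamP m.
have kl2 : (lam k < l)%R by rewrite kl1 gtrBl.
have := level_unattained dyadic_profile_decr dyadic_profile_half lamP kl2 nl m.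
move=> ml; apply: le_trans (ltW b) _.
by apply: ler_exp2z; rewrite lezD1.
Qed.

(** The shift by one puts both levels strictly above lam(k+1) when the level drops at k, as
    [level_part_N0] demands. *)
Definition level_diff (k : int) : V := (y (lam (k + 1) + 1) - y (lam k + 1))%R.

(** The A_0 side contributes 2 K + 2 K. The A_1 side contributes 4 2^(lam k) + 8 2^(lam k) <= 12
    phi(k), and the factor 2^k turns phi(k) into K(2^k); hence 12. *)
Lemma level_diff_J (k : int) : lam (k + 1)%R = (lam k - 1)%R ->
  J_functional G0 G1 (2 ^ k)%R (level_diff k) <= (12 * K_profile (2 ^ k))%:E.
Proof.
move=> jump; rewrite /J_functional ge_max; apply/andP; split.
  apply: le_trans (gagliardo_le h0 h1 _ _) _.
  have [_ _ ND NN] := h0; apply: le_trans (ND _ _) _; rewrite NN.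
  have l1 : (lam (k + 1) < lam (k + 1) + 1)%R by rewrite ltrDl.
  have l2 : (lam (k + 1) < lam k + 1)%R by rewrite jump ltrBlDr -addrA ltrDl.
  have b := level_part_N0 l1; have a := level_part_N0 l2.
  apply: le_trans (leeD b a) _; rewrite -EFinD lee_fin.
  have := K_profile_gt0 (exp2_gt0 k); lra.
have [_ _ GD GN] := ext_seminorm_gagliardo h0 h1 h1.
have -> : level_diff k = (- (f - y (lam (k + 1) + 1)) + (f - y (lam k + 1)))%R.
  by rewrite /level_diff opprB addrA subrK.
have c1 : (lam k = lam (k + 1) + 1)%R by rewrite jump subrK.
have c2 : (lam k = lam k + 1 - 1)%R by rewrite addrK.
have a := level_part_G1 (or_introl c1); have b := level_part_G1 (or_intror c2).
rewrite -lee_pdivlMl//; apply: le_trans (GD _ _) _; rewrite GN.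
apply: le_trans (leeD a b) _.
rewrite -EFinD -EFinM lee_fin jump subrK.
have /andP[c _] := lamP k.
rewrite mulrCA [(_^-1 * _)%R]mulrC expfzDr ?pnatr_eq0// expr1z.
lra.
Qed.

Lemma level_diff_J0 (k : int) : lam (k + 1)%R = lam k ->
  J_functional G0 G1 (2 ^ k)%R (level_diff k) = 0.
Proof.
move=> e; rewrite /level_diff e subrr /J_functional.
have [_ -> _ _] := ext_seminorm_gagliardo h0 h1 h0.
have [_ -> _ _] := ext_seminorm_gagliardo h0 h1 h1.
by rewrite mule0 maxxx.
Qed.

Lemma level_diff_carrier (k : int) :
  carrier G0 (level_diff k) /\ carrier G1 (level_diff k).
Proof.
have : J_functional G0 G1 (2 ^ k)%R (level_diff k) < +oo.
  have [e|e] := level_step dyadic_profile_decr dyadic_profile_half lamP k.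
    by rewrite level_diff_J0// ltry.
  by apply: le_lt_trans (level_diff_J e) _; rewrite ltry.
rewrite /J_functional gt_max => /andP[a b]; split; first exact: a.
rewrite /carrier/= ltey; apply/eqP => G1y.
by move: b; rewrite G1y gt0_muley ?lte_fin.
Qed.

Lemma level_diff_sum_nonneg n :
  (\sum_(i < n) level_diff (Posz i) = y (lam (Posz n) + 1) - y (lam 0 + 1))%R.
Proof.
elim: n => [|n ih]; first by rewrite big_ord0 subrr.
rewrite big_ord_recr/= ih /level_diff.
have -> : (Posz n + 1 = Posz n.+1)%R by rewrite -PoszD addn1.
by rewrite addrC addrA subrK.
Qed.

Lemma level_diff_sum_neg n :
  (\sum_(i < n) level_diff (Negz i) = y (lam 0 + 1) - y (lam (- Posz n) + 1))%R.
Proof.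
elim: n => [|n ih]; first by rewrite big_ord0 oppr0 subrr.
rewrite big_ord_recr/= ih /level_diff.
have -> : (Negz n + 1 = - Posz n)%R by rewrite NegzE -addn1 PoszD opprD subrK.
have -> : (Negz n = - Posz n.+1)%R by rewrite NegzE.
by rewrite addrA subrK.
Qed.

(** After telescoping, the error is the sum of -y at the lower end, small in A_0 because K tends to
    0 at 0, and of y - f at the upper end, small in the completion of A_1 because K(t)/t tends to 0
    at infinity. *)
Lemma level_diff_representation : J_representation G0 G1 f level_diff.
Proof.
have hG0 := ext_seminorm_gagliardo h0 h1 h0.
have hG1 := ext_seminorm_gagliardo h0 h1 h1.
split; first exact: level_diff_carrier.
apply: ge0_cvg0 => [p|e e0]; first exact: (K_functional_ge0 hG0 hG1).
have e20 : (0 < e / 2)%R by rewrite divr_gt0.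
have [N hN] : exists N : nat, forall n, (N <= n)%N -> N0 (y (lam (- Posz n) + 1)%R) <= (e / 2)%:E.
  (* The bound of [level_part_N0] carries a factor 2, so K is taken below e/4. *)
  have e40 : (0 < e / 4)%R by rewrite divr_gt0.
  have [t t0 ht] := K_profile_small e40.
  have [N hN] := exp2_unbounded t^-1; exists N => n Nn.
  have := level_part_N0 (k := (- Posz n - 1)%R) (l := (lam (- Posz n) + 1)%R).
  rewrite subrK ltrDl => /(_ isT) /le_trans; apply.
  rewrite lee_fin (_ : e / 2 = 2 * (e / 4))%R; last by field.
  rewrite ler_pM2l//; apply: le_trans ht; apply: K_profile_nondecreasing => //.
  apply: (@le_trans _ _ (2 ^ (- Posz N))%R).
    apply: ler_exp2z; rewrite -opprD lerN2 -PoszD lez_nat.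
    by rewrite (leq_trans Nn)// leq_addr.
  by rewrite -exprnN invf_ple ?posrE ?exprn_gt0.
have [M hM] : exists M : nat, forall n, (M <= n)%N -> G1 (f - y (lam (Posz n) + 1)%R)%R <= (e / 2)%:E.
  (* [level_part_G1] at level lam(n) + 1 gives 8 2^(lam n) <= 8 phi(n), so phi is taken below
     e/16. *)
  have e160 : (0 < e / 16)%R by rewrite divr_gt0.
  have [t t0 ht] := K_profile_div_small e160.
  have [M hM] := exp2_unbounded t; exists M => n Mn.
  have lamK : (lam (Posz n) = lam (Posz n) + 1 - 1)%R by rewrite addrK.
  apply: le_trans (level_part_G1 (or_intror lamK)) _.
  have /andP[a _] := lamP (Posz n).
  have b : (phi (Posz n) <= e / 16)%R.
    apply: le_trans (ltW ht); apply: K_profile_div_nonincreasing => //.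
    by apply: le_trans hM _; apply: ler_exp2z; rewrite lez_nat.
  have := le_trans a b.
  rewrite lee_fin expfzDr ?pnatr_eq0// expr1z; lra.
exists ([set n | (N <= n)%N], [set n | (M <= n)%N]) => /=.
  by split; [exists N|exists M].
move=> [a b] /= [Na Mb].
rewrite level_diff_sum_nonneg level_diff_sum_neg.
have -> : (y (lam 0 + 1) - y (lam (- Posz a) + 1) + (y (lam (Posz b) + 1) - y (lam 0 + 1)) - f =
    - y (lam (- Posz a) + 1) + - (f - y (lam (Posz b) + 1)))%R.
  by rewrite opprB [X in (X - f)%R]addrC addrA subrK addrAC addrC.
apply: le_trans (K_functional_le _ _ _ _ _) _; rewrite mul1e.
have [_ _ _ ->] := hG0; have [_ _ _ ->] := hG1.
rewrite [e]splitr EFinD; apply: leeD; last exact: hM.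
by apply: le_trans (gagliardo_le h0 h1 _ _) _; exact: hN.
Qed.

(** A domain independent of t allows sums of values of W to be exchanged with the integral. *)
Lemma weight_indicE (t : R) :
  weight v t = \int[mu]_(r in `]0%R, +oo[) (dweight v r * ((r < t)%R%:R)%:E).
Proof.
rewrite /weight integral_mkcond [RHS]integral_mkcond; apply: eq_integral => r _.
rewrite !patchE !mem_setE !in_itv/= andbT; case: (0 < r)%R => //=.
by case: (r < t)%R; rewrite ?mule1 ?mule0.
Qed.

Lemma level_pow_nonincr (k : int) : ((2 ^ lam (k + 1)) `^ q <= (2 ^ lam k) `^ q :> R)%R.
Proof. exact: (level_pow_decr dyadic_profile_decr dyadic_profile_half lamP q0). Qed.

(** Write each W(2^k) as an integral with the indicator of r < 2^k and exchange sum and integral.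
    For fixed r, [level_pow_sum] bounds the telescoping sum by (K(r)/r)^q, whose integral is I. *)
Lemma level_weight_sum (lo : int) n :
  \sum_(i < n) ((2 ^ lam (lo + Posz i)) `^ q - (2 ^ lam (lo + Posz i + 1)) `^ q)%:E *
     weight v (2 ^ (lo + Posz i))%R <= I.
Proof.
pose d i : R := ((2 ^ lam (lo + Posz i)) `^ q - (2 ^ lam (lo + Posz i + 1)) `^ q)%R.
have d0 i : (0 <= d i)%R.
  by rewrite subr_ge0; exact: level_pow_nonincr.
pose g i r : \bar R := dweight v r * ((r < 2 ^ (lo + Posz i))%R%:R)%:E.
have g0 i r : r \in `]0%R, +oo[ -> 0 <= g i r.
  by rewrite in_itv/= andbT => r0; rewrite mule_ge0 ?dweight_ge0// lee_fin.
have mg i : measurable_fun (`]0%R, +oo[ : set (lebesgueR R)) (g i : lebesgueR R -> \bar R).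
  apply: emeasurable_funM; first exact: measurable_dweight.
  apply: measurable_fun_lebesgueR; first exact: measurable_itv.
  apply/measurable_EFinP; apply: (measurable_funS measurableT) => //.
  apply: (@measurableT_comp _ _ _ _ _ _ (fun b : bool => b%:R : R)%R _ (fun r : R => r < 2 ^ (lo + Posz i))%R) => //.
  by apply: measurable_fun_ltr.
have mdg i : measurable_fun (`]0%R, +oo[ : set (lebesgueR R))
    ((fun r => (d i)%:E * g i r) : lebesgueR R -> \bar R).
  by apply: measurable_funeM.
have dg0 i r : (`]0%R, +oo[%classic : set R) r -> 0 <= (d i)%:E * g i r.
  by move=> /g0 gr; apply: mule_ge0 => //; rewrite lee_fin d0.
rewrite (eq_bigr (fun i : 'I_n => \int[mu]_(r in `]0%R, +oo[) ((d i)%:E * g i r))); last first.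
  by move=> i _; rewrite weight_indicE ge0_integral_itvZl; [|exact: mg|exact: g0|exact: d0].
rewrite -(big_mkord xpredT (fun i => \int[mu]_(r in `]0%R, +oo[) ((d i)%:E * g i r))).
rewrite -(@ge0_integral_sum _ (lebesgueR R) R mu _ (measurable_itv_lebesgueR _) _ (fun i r => (d i)%:E * g i r) mdg dg0).
rewrite K_integralE; apply: ge0_le_integral_nomeas => r /= ri.
  by apply: sume_ge0 => i _; exact: dg0.
have r0 : (0 < r)%R by move: ri; rewrite in_itv/= andbT.
rewrite (eq_bigr (fun i => dweight v r * (d i * (r < 2 ^ (lo + Posz i))%R%:R)%:E)); last first.
  by move=> i _; rewrite /g muleCA -EFinM.
rewrite -ge0_sume_distrr; last by move=> i _; rewrite lee_fin mulr_ge0.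
apply: lee_wpmul2l; first exact: dweight_ge0.
rewrite sumEFin lee_fin big_mkord.
apply: (level_pow_sum dyadic_profile_decr dyadic_profile_half lamP q0); first exact: powR_ge0.
move=> k rk; apply: ge0_ler_powR; rewrite ?nnegrE ?(ltW q0)//.
- exact: K_profile_div_ge0.
- exact: K_profile_div_ge0.
- by apply: K_profile_div_nonincreasing => //; exact: ltW.
Qed.

(** Without a drop the term is 0. At a drop, 12^q comes from [level_diff_J] and the other factor
    from [level_pow_drop]. *)
Lemma J_term_level_diff (k : int) :
  J_term N0 N1 v q level_diff k <= (12 `^ q * (2 `^ q / (1 - 2 `^ (- q))))%:E *
    (((2 ^ lam k) `^ q - (2 ^ lam (k + 1)) `^ q)%:E * weight v (2 ^ k)%R).
Proof.
have W0 := weight_ge0 v_gt0 (2 ^ k)%R.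
have d0 : (0 <= (2 ^ lam k) `^ q - (2 ^ lam (k + 1)) `^ q :> R)%R.
  by rewrite subr_ge0; exact: level_pow_nonincr.
have c0 : (0 <= 12 `^ q * (2 `^ q / (1 - 2 `^ (- q))) :> R)%R.
  rewrite mulr_ge0 ?divr_ge0 ?powR_ge0// subr_ge0 powRN invf_le1 ?powR_gt0//.
  by rewrite -[leLHS](powRr0 2); apply: ler_powR; rewrite ?ler1n ?ltW.
rewrite /J_term; have [e|e] := level_step dyadic_profile_decr dyadic_profile_half lamP k.
  rewrite level_diff_J0// poweR0r ?gt_eqF// mule0.
  by rewrite mule_ge0// ?mule_ge0// ?lee_fin.
rewrite muleAC [leRHS]muleA; apply: lee_wpmul2r => //.
apply: (@le_trans _ _ (((2 ^ k) `^ (- q))%:E * ((12 * K_profile (2 ^ k)) `^ q)%:E)).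
  apply: lee_wpmul2l; first by rewrite lee_fin powR_ge0.
  rewrite -poweR_EFin; apply: gt0_ler_poweR; rewrite ?in_itv/= ?leey ?(ltW q0)//.
  - by rewrite (J_functional_ge0 h0 h1).
  - by rewrite lee_fin mulr_ge0 ?K_profile_ge0.
  - exact: level_diff_J.
rewrite -!EFinM lee_fin.
have -> : ((2 ^ k) `^ (- q) * (12 * K_profile (2 ^ k)) `^ q = 12 `^ q * (phi k) `^ q :> R)%R.
  rewrite powRM ?K_profile_ge0// powRM ?invr_ge0 ?K_profile_ge0 ?(ltW (exp2_gt0 k))//.
  by rewrite -(powR_inv1 (ltW (exp2_gt0 k))) -(powRrM _ _ q) mulN1r; ring.
rewrite -mulrA; apply: ler_wpM2l; first exact: powR_ge0.
exact: (level_pow_drop lamP q0).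
Qed.

End Profile.

Section KtoJ.
Context {R : realType} {V : lmodType R}.
Local Notation mu := (@completed_lebesgue_measure R).
Variables N0 N1 : V -> \bar R.
Hypotheses (h0 : ext_seminorm N0) (h1 : ext_seminorm N1).
Variable v : R -> R.
Hypothesis v_gt0 : forall t : R, (0 < t)%R -> (0 < v t)%R.
Hypothesis mv : measurable_fun (`]0%R, +oo[ : set (lebesgueR R)) (v : lebesgueR R -> R).
Hypothesis vratio : sv_ratio v.
Hypothesis W1 : weight v 1 < +oo.
Hypothesis Winfty : \int[mu]_(r in `]1%R, +oo[) dweight v r = +oo.

Lemma J_representation_le_K_integral (q : R) : (0 < q)%R ->
  exists2 C : R, (0 < C)%R & forall f, sum_space N0 N1 f ->
    K_integral N0 N1 v q f < +oo ->
    exists2 u, J_representation (gagliardo N0 N1 N0) (gagliardo N0 N1 N1) f u &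
      \esum_(k in [set: int]) J_term N0 N1 v q u k <= C%:E * K_integral N0 N1 v q f.
Proof.
move=> q0; pose C : R := (12 `^ q * (2 `^ q / (1 - 2 `^ (- q))))%R.
have C0 : (0 < C)%R.
  rewrite /C mulr_gt0 ?divr_gt0 ?powR_gt0// subr_gt0 powRN invf_lt1 ?powR_gt0//.
  by rewrite -[ltLHS](powRr0 2) /powR pnatr_eq0/= ltr_expR ltr_pM2r// ln_gt0// ltr1n.
exists C => // f fsum Ify.
have hG0 := ext_seminorm_gagliardo h0 h1 h0.
have hG1 := ext_seminorm_gagliardo h0 h1 h1.
have I0 : 0 <= K_integral N0 N1 v q f.
  apply: integral_ge0 => r /=; rewrite in_itv/= andbT => r0.
  by rewrite mule_ge0 ?poweR_ge0// lee_fin mulr_ge0 ?powR_ge0 ?(ltW (v_gt0 r0)).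
(* If K(1, f) = 0 there are no dyadic levels. The constant sequence 0 then converges to f in the sum
   norm, so f has Gagliardo norm 0 and the zero representation serves. *)
have [K0|K0] := eqVneq (K_functional N0 N1 1 f) 0.
  have [_ G00 _ _] := hG0; have [_ G10 _ _] := hG1; have [_ N00 _ _] := h0.
  exists (fun=> 0%R).
    split; first by move=> k; rewrite /carrier/= G00 G10.
    apply: ge0_cvg0 => [p|e e0]; first exact: (K_functional_ge0 hG0 hG1).
    apply: nearW => p; rewrite !sumr_const !mul0rn addr0 add0r.
    apply: le_trans (K_functional_le0 _ hG1 1%R _) _.
    have [_ _ _ ->] := hG0.
    apply: (@le_trans _ _ 0); last by rewrite lee_fin ltW.
    apply: (@gagliardo_le_lim _ _ _ _ _ _ (fun=> 0%R)).
      by move=> n; rewrite N00.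
    rewrite sub0r /sum_norm; have [_ _ _ ->] := ext_seminorm_K h0 h1 (@ler01 R).
    by rewrite K0; exact: cvg_cst.
  rewrite esum1 ?mule_ge0 ?lee_fin ?(ltW C0)// => k _.
  by rewrite /J_term /J_functional G00 G10 mule0 maxxx poweR0r ?gt_eqF// mule0.
(* By [K_functional_scale], a zero of K at any t > 0 would force K(1, f) = 0. *)
have Kpos t : (0 < t)%R -> (0 < K_profile N0 N1 f t)%R.
  move=> t0; rewrite lt_neqAle K_profile_ge0// andbT eq_sym; apply/eqP => Kt.
  have := K_functional_scale h0 h1 f t0 (@ltr01 R).
  rewrite -(K_profileE h0 h1 fsum t0) Kt mule0 => K1.
  by move/eqP: K0; apply; apply/eqP; rewrite eq_le K1 K_functional_ge0.
have e2 (k : int) : (0 < 2 ^ k :> R)%R by exact: exprz_gt0.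
have [lam lamP] : exists lam : int -> int, forall k,
    (2 ^ lam k <= K_profile N0 N1 f (2 ^ k) / 2 ^ k < 2 ^ (lam k + 1))%R.
  have [|lam lamP] := @choice int int (fun k l => (2 ^ l <= K_profile N0 N1 f (2 ^ k) / 2 ^ k < 2 ^ (l + 1))%R); last by exists lam.
  by move=> k; apply: dyadic_level; rewrite divr_gt0 ?Kpos.
have [y yP] := choice (exists_level_part h0 h1 fsum Kpos lam).
exists (level_diff lam y).
  exact: (level_diff_representation h0 h1 v_gt0 mv vratio W1 Winfty q0 fsum Ify Kpos lamP yP).
apply: esum_int_le => [k|lo n]; first exact: J_term_ge0.
have key k := J_term_level_diff h0 h1 v_gt0 mv vratio W1 q0 fsum Ify Kpos lamP yP k.
apply: le_trans (lee_sum _ (fun (i : 'I_n) _ => key (lo + Posz i)%R)) _.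
rewrite -ge0_sume_distrr; last first.
  move=> i _; rewrite mule_ge0 ?weight_ge0// lee_fin subr_ge0.
  exact: (level_pow_nonincr h0 h1 q0 fsum lamP).
apply: lee_wpmul2l; first by rewrite lee_fin (ltW C0).
exact: (level_weight_sum h0 h1 v_gt0 mv q0 fsum lamP).
Qed.

End KtoJ.

(** * The equivalence *)

Lemma ext_seminorm_emb_norm (R : realType) (A : normedModType R) (V : lmodType R)
    (i : {linear A -> V}) : ext_seminorm (emb_norm i).
Proof.
have ge0 f : 0 <= emb_norm i f.
  by apply: le_ereal_inf_tmp => _ [a _ <-]; rewrite lee_fin.
have le (a : A) : emb_norm i (i a) <= `|a|%R%:E.
  by apply: ereal_inf_lbound; exists a.
have opp f : emb_norm i (- f)%R <= emb_norm i f.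
  apply: le_ereal_inf_tmp => _ [a /= <- <-].
  by rewrite -linearN -normrN le.
split=> //.
- apply/eqP; rewrite eq_le ge0 andbT -(linear0 i).
  by apply: le_trans (le _) _; rewrite normr0.
- move=> f g; apply: le_ereal_infD.
  + by move=> _ [a _ <-]; rewrite lee_fin.
  + by move=> _ [a _ <-]; rewrite lee_fin.
  + move=> _ _ [a /= <- <-] [c /= <- <-].
    rewrite -linearD; apply: le_trans (le _) _.
    by rewrite -EFinD lee_fin ler_normD.
- by move=> f; apply/eqP; rewrite eq_le opp/= -{1}[f]opprK opp.
Qed.

Section Equivalence.
Context {R : realType} {V : lmodType R}.
Local Notation mu := (@completed_lebesgue_measure R).
Variables N0 N1 : V -> \bar R.
Hypotheses (h0 : ext_seminorm N0) (h1 : ext_seminorm N1).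
Local Notation G0 := (gagliardo N0 N1 N0).
Local Notation G1 := (gagliardo N0 N1 N1).
Variables (b : R -> \bar R) (q : R).
Hypotheses (q0 : (0 < q)%R) (q1 : (q <= 1)%R) (svb : slowly_varying b).
Local Notation v := (sv_pow b q).
Local Notation B := (fun t : R => weight v t `^ q^-1).

Lemma K_normE f : K_norm N0 N1 q b f = K_integral N0 N1 v q f `^ q^-1.
Proof.
rewrite /K_norm Lq_normE ?gt_eqF//; congr (_ `^ _); apply: eq_integral => r.
rewrite inE/= in_itv/= andbT => r0.
have br : 0 <= b r by have [b0 _ _ _ _] := svb; rewrite ltW// b0.
have Kr : 0 <= K_functional N0 N1 r f by exact: (K_functional_ge0 h0 h1 _ (ltW r0)).
rewrite gee0_abs ?mule_ge0 ?lee_fin ?powR_ge0//.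
rewrite !poweRM ?mule_ge0 ?lee_fin ?powR_ge0// poweR_EFin -sv_powE// -EFinM -powRrM.
by rewrite mulrBl mulN1r mulVf ?gt_eqF.
Qed.

Lemma J_quantityE u :
  J_quantity G0 G1 q B u = (\esum_(k in [set: int]) J_term N0 N1 v q u k) `^ q^-1.
Proof.
congr (_ `^ _); apply: eq_esum => k _.
have e2 : (0 < 2 ^ k :> R)%R by exact: exprz_gt0.
have W0 : 0 <= weight v (2 ^ k)%R by apply: weight_ge0 => t; exact: sv_pow_gt0.
have J0 := J_functional_ge0 h0 h1 (2 ^ k)%R (u k).
have e2N : (0 <= 2 ^ (- k) :> R)%R by exact: exprz_ge0.
rewrite !poweRM ?mule_ge0 ?poweR_ge0 ?lee_fin//.
rewrite -poweRrM mulVf ?gt_eqF// poweRe1; last exact: W0.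
rewrite /J_term poweR_EFin.
rewrite (_ : (2 ^ (- k)) `^ q = (2 ^ k) `^ (- q) :> R)%R//.
by rewrite -invr_expz -(powR_inv1 (ltW e2)) -powRrM mulN1r.
Qed.

Hypothesis b01 : Lq_norm q `]0%R, 1%R[ (fun t => (t `^ (- q^-1))%:E * b t) < +oo.
Hypothesis b1y : Lq_norm q `]1%R, +oo[ (fun t => (t `^ (- q^-1))%:E * b t) = +oo.

Let iq0 : (0 < q^-1)%R. Proof. by rewrite invr_gt0. Qed.

Lemma weight_sv_pow1 : weight v 1 < +oo.
Proof.
move: b01; rewrite Lq_norm_sv//; last by move=> r; rewrite in_itv/= => /andP[].
by move=> h; apply: lty_poweRy h; rewrite gt_eqF.
Qed.

Lemma integral_sv_powy : \int[mu]_(r in `]1%R, +oo[) dweight v r = +oo.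
Proof.
move: b1y; rewrite Lq_norm_sv//; first exact: poweR_eqy.
by move=> r; rewrite in_itv/= andbT; exact: lt_trans.
Qed.

Lemma K_norm_le_J_quantity : exists2 C : R, (0 < C)%R &
  forall f u, J_representation G0 G1 f u ->
    K_norm N0 N1 q b f <= C%:E * J_quantity G0 G1 q B u.
Proof.
have [C C0 hC] := K_integral_le_J h0 h1 (fun t => @sv_pow_gt0 _ b q t svb)
  (measurable_sv_pow q svb) (sv_ratio_sv_pow q0 svb) q0 q1.
exists (C `^ q^-1)%R => [|f u fu]; first exact: powR_gt0.
have E0 : 0 <= \esum_(k in [set: int]) J_term N0 N1 v q u k.
  apply: esum_ge0 => k _; apply: J_term_ge0 => //.
  by move=> t; exact: sv_pow_gt0.
rewrite K_normE J_quantityE -poweR_EFin -poweRM ?lee_fin ?(ltW C0)//.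
have K0 : 0 <= K_integral N0 N1 v q f.
  apply: integral_ge0 => r /=; rewrite in_itv/= andbT => r0.
  by rewrite mule_ge0 ?poweR_ge0// lee_fin mulr_ge0 ?powR_ge0 ?(ltW (sv_pow_gt0 q svb r0)).
apply: gt0_ler_poweR; rewrite ?in_itv/= ?leey ?andbT ?(ltW iq0) ?K0//.
  by rewrite mule_ge0 ?lee_fin ?(ltW C0).
exact: hC.
Qed.

Lemma J_quantity_le_K_norm : exists2 C : R, (0 < C)%R &
  forall f, sum_space N0 N1 f -> K_norm N0 N1 q b f < +oo ->
    exists2 u, J_representation G0 G1 f u &
      J_quantity G0 G1 q B u <= C%:E * K_norm N0 N1 q b f.
Proof.
have [C C0 hC] := J_representation_le_K_integral h0 h1 (fun t => @sv_pow_gt0 _ b q t svb)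
  (measurable_sv_pow q svb) (sv_ratio_sv_pow q0 svb) weight_sv_pow1 integral_sv_powy q0.
exists (C `^ q^-1)%R => [|f fsum]; first exact: powR_gt0.
rewrite K_normE => Kf.
have Ify : K_integral N0 N1 v q f < +oo by apply: lty_poweRy Kf; rewrite gt_eqF.
have [u fu ule] := hC f fsum Ify.
exists u => //.
have K0 : 0 <= K_integral N0 N1 v q f.
  apply: integral_ge0 => r /=; rewrite in_itv/= andbT => r0.
  by rewrite mule_ge0 ?poweR_ge0// lee_fin mulr_ge0 ?powR_ge0 ?(ltW (sv_pow_gt0 q svb r0)).
have E0 : 0 <= \esum_(k in [set: int]) J_term N0 N1 v q u k.
  apply: esum_ge0 => k _; apply: J_term_ge0 => //.
  by move=> t; exact: sv_pow_gt0.
rewrite J_quantityE -poweR_EFin -poweRM ?lee_fin ?(ltW C0)//.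
apply: gt0_ler_poweR; rewrite ?in_itv/= ?leey ?andbT ?(ltW iq0) ?E0//.
by rewrite mule_ge0 ?lee_fin ?(ltW C0).
Qed.

(** Membership is finiteness of K at 1, which passes from the completed couple to the original one;
    the converse holds because the Gagliardo norms are smaller. *)
Lemma sum_space_gagliardo f : sum_space G0 G1 f <-> sum_space N0 N1 f.
Proof.
split=> [|[x x0 [y y1 <-]]].
  have hG0 := ext_seminorm_gagliardo h0 h1 h0.
  have hG1 := ext_seminorm_gagliardo h0 h1 h1.
  move=> /(sum_spaceP hG0 hG1 f (@ltr01 R)) Gf.
  apply/(sum_spaceP h0 h1 f (@ltr01 R)); apply: le_lt_trans Gf.
  exact: (K_functional_le_K_gagliardo h0 h1).
exists x; first exact: (le_lt_trans (gagliardo_le h0 h1 N0 x)).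
by exists y => //; exact: (le_lt_trans (gagliardo_le h0 h1 N1 y)).
Qed.

Lemma K_spaceE : K_space N0 N1 q b = J_space G0 G1 q B.
Proof.
have [C C0 hC] := K_norm_le_J_quantity.
have [D D0 hD] := J_quantity_le_K_norm.
have lty (c : R) (x : \bar R) : 0 <= x -> x < +oo -> c%:E * x < +oo.
  by move=> x0 xy; rewrite -(@fineK _ x) ?ge0_fin_numE// -EFinM ltry.
apply/seteqP; split => f [fsum].
  move=> Kf; split; first exact/sum_space_gagliardo.
  have [u fu hu] := hD f fsum Kf; exists u => //.
  apply: le_lt_trans hu _; apply: lty => //; exact: Lnorm_ge0.
move=> [u fu Ju]; split; first exact/sum_space_gagliardo.
apply: le_lt_trans (hC f u fu) _; apply: lty => //; exact: poweR_ge0.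
Qed.

(** The bound with C holds for every representation and so passes to the infimum; the bound with D
    needs only the one constructed representation. *)
Lemma K_norm_equivalent : equivalent_norms (K_space N0 N1 q b)
  (K_norm N0 N1 q b) (J_norm G0 G1 q B).
Proof.
have [C C0 hC] := K_norm_le_J_quantity.
have [D D0 hD] := J_quantity_le_K_norm.
have CD0 : (0 < C + D)%R by rewrite addr_gt0.
exists (C + D)%R => // f [fsum Kf]; split.
  rewrite -lee_pdivrMl//; apply: le_ereal_inf_tmp => _ [u fu <-].
  rewrite lee_pdivrMl//; apply: le_trans (hC f u fu) _.
  by apply: lee_wpmul2r; [exact: poweR_ge0|rewrite lee_fin lerDl ltW].
have [u fu hu] := hD f fsum Kf.
apply: (@le_trans _ _ (J_quantity G0 G1 q B u)).
  by apply: ereal_inf_lbound; exists u.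
apply: le_trans hu _.
by apply: lee_wpmul2r; [exact: Lnorm_ge0|rewrite lee_fin lerDr ltW].
Qed.

End Equivalence.

Theorem theorem3p5 (R : realType) (A : banach_couple R) (q : R)
    (b : R -> \bar R) :
  (0 < q)%R -> (q <= 1)%R ->
  slowly_varying b ->
  Lq_norm q `]0%R, 1%R[ (fun t => (t `^ (- q^-1))%:E * b t) < +oo ->
  Lq_norm q `]1%R, +oo[ (fun t => (t `^ (- q^-1))%:E * b t) = +oo ->
  let B := fun t : R =>
    Lq_norm q `]0%R, t[ (fun s => (s `^ (- q^-1))%:E * b s) in
  [/\ slowly_varying B,
      K_space (norm0 A) (norm1 A) q b = J_space (gagliardo0 A) (gagliardo1 A) q B
    & equivalent_norms (K_space (norm0 A) (norm1 A) q b)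
        (K_norm (norm0 A) (norm1 A) q b)
        (J_norm (gagliardo0 A) (gagliardo1 A) q B)].
Proof.
move=> q0 q1 svb b01 b1y B.
have -> : B = fun t : R => weight (sv_pow b q) t `^ q^-1.
  apply/funext => t; rewrite /B Lq_norm_sv// => r.
  by rewrite in_itv/= => /andP[].
have h0 : ext_seminorm (norm0 A) by exact: ext_seminorm_emb_norm.
have h1 : ext_seminorm (norm1 A) by exact: ext_seminorm_emb_norm.
split.
- apply: slowly_varying_weight => //.
  + by move=> t; exact: sv_pow_gt0.
  + exact: measurable_sv_pow.
  + exact: sv_ratio_sv_pow.
  + exact: (weight_sv_pow1 q0 svb b01).
- exact: K_spaceE.
- exact: K_norm_equivalent.
Qed.
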